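(* Let $U$ (with $\tau$-operator $\mathcal{T}$) be a folded representation over $k$ of a root datum $\Phi\hookrightarrow\Lambda^\vee$ with simple roots $\Delta$, preserving $\Theta\subset\Delta$. Let $\theta\in U$ be a dominant vector with respect to $\Delta$ whose stabilizer in $W$ is $W_\Theta$, and $\mu=\pi_*(\theta)$. Then the cube of $k$-algebra homomorphisms formed by the Borel maps $\rho,\bar\rho,\rho_\tau,\bar\rho_\tau$, the maps $\iota^*,\bar\iota^*$, the quotient maps $f,f_\tau$, the augmentations and the maps induced by $\pi_*$ commutes, that is: 1. $f\circ\rho=\bar\rho\circ(\epsilon\otimes\mathrm{id})$ on $S\otimes_{S^W}S^{W_\Theta}$; 2. $f_\tau\circ\rho_\tau=\bar\rho_\tau\circ(\epsilon_\tau\otimes\mathrm{id})$ on $S_\tau\otimes_{S_\tau^{W_\tau}}S_\tau^{W_{\Theta_\tau}}$; 3. $\iota^*\circ\rho=\rho_\tau\circ(\pi_*\otimes\pi_* )$ on $S\otimes_{S^W}S^{W_\Theta}$; 4. $\bar\iota^*\circ\bar\rho=\bar\rho_\tau\circ\bar\pi$ on $k\otimes_{S^W}S^{W_\Theta}$, where $\bar\pi\colon k\otimes_{S^W}S^{W_\Theta}\to l_*\otimes_{S_\tau^{W_\tau}}S_\tau^{W_{\Theta_\tau}}$, $r\otimes s\mapsto r\otimes\pi_*(s)$; 5. $(\epsilon_\tau\otimes\mathrm{id})\circ(\pi_*\otimes\pi_* )=\bar\pi\circ(\epsilon\otimes\mathrm{id})$ on $S\otimes_{S^W}S^{W_\Theta}$;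 6. $f_\tau\circ\iota^*=\bar\iota^*\circ f$ on $\mathcal{Z}(\mathcal{G})$.
   Context: **Quadratic algebra.** $k$ is a subring of $\mathbb{R}$; $p(x)=x^2-c_1x+c_2$ is a polynomial over $k$ with $c_2$ and $D=c_1^2-4c_2$ invertible in $k$; $l=k[x]/(p(x))$; $\tau$ is the class of $x$ and $\sigma=c_1-\tau$, so $\tau+\sigma=c_1$, $\tau\sigma=c_2$. Write $(y,y')=y+\tau y'\in l$ for $y,y'\in k$. Two cases are considered: the split case, where $p(x)=x^2-1$, $2$ is invertible in $k$ and $l\cong k\times k$; and the non-split case, where $l\not\cong k\times k$ and $l$ is a subring of $\mathbb{R}$. **Weil restriction.** $\mathcal{U}=l^n$; $U$ is $\mathcal{U}$ viewed as a free $k$-module of rank $2n$ (coordinates $(y_i,y_i')_{i}$); for $u\in U$, $u_l$ is $u$ viewed in $\mathcal{U}$. $\mathcal{T}\colon U\to U$ is multiplication by $\tau$, $(\mathcal{T}u)_l=\tau u_l$. $B_\tau(u,\hat u)=pr_\tau(u_l\cdot\hat u_l)$, where $\cdot$ is the standard $l$-bilinear dot product on $\mathcal{U}$ and $pr_\tau(y+\tau y')=y$. $U_l=U\otimes_kl$, $\mathcal{T}_l$ and $B_\tau$ are extended $l$-linearly; $U_\tau$ is the $\tau$-eigenspace of $\mathcal{T}_l$ and $\pi_\tau\colon U\to U_\tau$, $\pi_\tau(u)=\frac{1}{\tau-\sigma}(\mathcal{T}u-\sigma u)$. A nonzero $u\in U$ is $\tau$-rational if $u_l\cdot u_l\in k$.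 **Root datum and folded representation.** A root datum is an embedding $\Phi\hookrightarrow\Lambda^\vee$, $\alpha\mapsto\alpha^\vee$, of a non-empty finite subset $\Phi$ of a free finitely generated abelian group $\Lambda$ into $\Lambda^\vee=\mathrm{Hom}(\Lambda,\mathbb{Z})$ with $\Phi\cap2\Phi=\emptyset$, $\alpha^\vee(\alpha)=2$, $\beta-\alpha^\vee(\beta)\alpha\in\Phi$ and $\beta^\vee-\beta^\vee(\alpha)\alpha^\vee\in\Phi^\vee$ for all $\alpha,\beta\in\Phi$ ($\Phi^\vee$ is the image of $\Phi$). $\Lambda_r$ is the subgroup generated by $\Phi$ (root lattice), $\Delta$ is a fixed set of simple roots, $\Phi^+$ the positive roots. $U$ is a folded representation of it if $\Phi\subset U$ (so $\Lambda_r\subset U$) and: (1) $U$ is the Weil restriction of $\mathcal{U}=l^n$ with respect to $l/k$, i.e. $U$ is the free $l$-module $\mathcal{U}=l^n$ viewed as a free $k$-module of rank $2n$ with coordinates $(y_i,y_i')_i$, where $l=k[x]/(p(x))$ and $x_i=y_i+\tau y_i'$ are the coordinates in $l^n$; (2) the standard dot product $B$ on $U$ in the coordinates $(y_i,y_i')$ equals $B_\tau$ (so $c_2=-1$), and $\alpha^\vee(u)=2B(\alpha,u)/B(\alpha,\alpha)$; the reflections $r_\alpha(u)=u-\alpha^\vee(u)\alpha$, $\alpha\in\Phi$, are $k$-linear automorphisms of $U$; (3) $\mathcal{T}(\Lambda_r)=\Lambda_r$; (4) $\Delta=\Delta^{\mathcal{T}}\amalg\Delta_{rat}\amalg\mathcal{T}(\Delta_{rat})$,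 where $\Delta^{\mathcal{T}}=\{\alpha\in\Delta:\mathcal{T}\alpha=\alpha\}$ and $\Delta_{rat}$ is a subset consisting of $\tau$-rational simple roots. In the non-split case $\tau>0$ is assumed (and then $\Delta^{\mathcal{T}}=\emptyset$). $W$ is the Weyl group generated by the $r_\alpha$, $\alpha\in\Delta$. **Convention.** In the non-split case put $U_*=U_\tau$, $\pi_*=\pi_\tau$, $l_*=l$. In the split case put $U_*=U_1=\{u\in U:\mathcal{T}u=u\}$, $\pi_*(u)=\frac12(u+\mathcal{T}u)$, $l_*=k$. **Twisted folding.** For $\alpha\in\Delta_{rat}\amalg\Delta^{\mathcal{T}}$ put $\bar\alpha=\pi_*(\alpha)$; $R_{\bar\alpha}$ is the restriction to $U_*$ of ($l_*$-linearly extended) $r_{\mathcal{T}\alpha}r_\alpha$ if $\alpha\in\Delta_{rat}$, and of $r_\alpha$ if $\alpha\in\Delta^{\mathcal{T}}$. $W_\tau$ is the group generated by these $R_{\bar\alpha}$; it is identified with the subgroup of $W$ generated by the corresponding $r_{\mathcal{T}\alpha}r_\alpha$ and $r_\alpha$. $\Delta_\tau=\pi_*(\Delta_{rat}\amalg\Delta^{\mathcal{T}})$, $\Phi_\tau=W_\tau(\Delta_\tau)$, $\Phi_\tau^+$ are the roots that are nonnegative combinations of $\Delta_\tau$; for $\beta=w(\bar\alpha)\in\Phi_\tau$, $R_\beta=wR_{\bar\alpha}w^{-1}$. **Parabolic data.** $(U,\mathcal{T})$ preserves $\Theta\subset\Delta$ if $\mathcal{T}(\langle\Theta\rangle_k)=\langle\Theta\rangle_k$,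 where $\langle\Theta\rangle_k$ is the $k$-span. $W_\Theta\subset W$ is generated by the $r_\alpha$, $\alpha\in\Theta$; $W_{\Theta_\tau}\subset W_\tau$ is generated by the $R_{\bar\alpha}$ with $\alpha\in\Theta\cap(\Delta_{rat}\amalg\Delta^{\mathcal{T}})$. A vector $\theta\in U$ is dominant if $B_\tau(\theta,\beta)\ge0$ for all $\beta\in\Delta$. The map $\iota\colon W_\tau\mu\hookrightarrow W\theta$, $w\mu\mapsto w\theta$ ($w\in W_\tau\subset W$) is a well-defined injection. **Structure algebras.** $\Lambda$ is regarded as a subgroup of $U$ containing $\Lambda_r$, stable under $\mathcal{T}$ and $W$, with $\alpha^\vee$ given by the formula $\alpha^\vee(u)=2B(\alpha,u)/B(\alpha,\alpha)$. $S=\mathrm{Sym}_k(\Lambda)$; $\Lambda_\tau$ is the $l_*$-span of $\pi_*(\Lambda)$ in $U_*$, a free $l_*$-module; $S_\tau=\mathrm{Sym}_{l_*}(\Lambda_\tau)$; $\pi_*$ induces a graded $k$-algebra homomorphism $\pi_*\colon S\to S_\tau$. With componentwise operations, $$\mathcal{Z}(\mathcal{G})=\Big\{(z_x)\in\bigoplus_{x\in W\theta}S : z_x-z_{r_\alpha x}\in\alpha S\ \ \forall x\in W\theta,\ \alpha\in\Phi^+\Big\},$$ $$\mathcal{Z}(\mathcal{G}_\tau)=\Big\{(b_y)\in\bigoplus_{y\in W_\tau\mu}S_\tau : b_y-b_{R_\beta y}\in\beta S_\tau\ \ \forall y\in W_\tau\mu,\ \beta\in\Phi_\tau^+\Big\}.$$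 $\epsilon\colon S\to k$ and $\epsilon_\tau\colon S_\tau\to l_*$ are the augmentations (constant term), with kernels $\mathcal{I}$, $\mathcal{I}_\tau$. $\overline{\mathcal{Z}}(\mathcal{G})=\mathcal{Z}(\mathcal{G})/\mathcal{I}\mathcal{Z}(\mathcal{G})$ and $\overline{\mathcal{Z}}(\mathcal{G}_\tau)=\mathcal{Z}(\mathcal{G}_\tau)/\mathcal{I}_\tau\mathcal{Z}(\mathcal{G}_\tau)$, with quotient maps $f$, $f_\tau$. **Maps.** $\iota^*\colon\mathcal{Z}(\mathcal{G})\to\mathcal{Z}(\mathcal{G}_\tau)$, $(z_x)_{x\in W\theta}\mapsto(\pi_*(z_{\iota(y)}))_{y\in W_\tau\mu}$ is a ring homomorphism and $\bar\iota^*\colon\overline{\mathcal{Z}}(\mathcal{G})\to\overline{\mathcal{Z}}(\mathcal{G}_\tau)$ is the induced map. Characteristic maps: $c\colon S^{W_\Theta}\to\mathcal{Z}(\mathcal{G})$, $s\mapsto(w(s))_{w\theta}$, and $c_\tau\colon S_\tau^{W_{\Theta_\tau}}\to\mathcal{Z}(\mathcal{G}_\tau)$, $s\mapsto(w(s))_{w\mu}$. Borel maps: $\rho\colon S\otimes_{S^W}S^{W_\Theta}\to\mathcal{Z}(\mathcal{G})$, $s_1\otimes s_2\mapsto s_1c(s_2)$; $\rho_\tau\colon S_\tau\otimes_{S_\tau^{W_\tau}}S_\tau^{W_{\Theta_\tau}}\to\mathcal{Z}(\mathcal{G}_\tau)$, $s_1\otimes s_2\mapsto s_1c_\tau(s_2)$;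 $\bar\rho\colon k\otimes_{S^W}S^{W_\Theta}\to\overline{\mathcal{Z}}(\mathcal{G})$, $r\otimes s\mapsto rf(c(s))$; $\bar\rho_\tau\colon l_*\otimes_{S_\tau^{W_\tau}}S_\tau^{W_{\Theta_\tau}}\to\overline{\mathcal{Z}}(\mathcal{G}_\tau)$, $r\otimes s\mapsto rf_\tau(c_\tau(s))$. In the tensor products $k$ and $l_*$ are modules over the invariants via $\epsilon$ and $\epsilon_\tau$. *)

(* Defs.v *)
From HB Require Import structures.
From mathcomp Require Import all_boot all_order all_algebra.
From mathcomp Require Import generic_quotient ring_quotient qpoly.
From mathcomp Require Import boolp classical_sets functions reals.
From mathcomp.multinomials Require Import freeg mpoly.

Set Implicit Arguments.
Unset Strict Implicit.
Unset Printing Implicit Defensive.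

Import Order.TTheory GRing.Theory Num.Theory.

Local Open Scope classical_set_scope.
Local Open Scope quotient_scope.
Local Open Scope ring_scope.

Section Invariants.
Variables (A : comNzRingType) (T : Type) (act : T -> {rmorphism A -> A}).
Variable G : T -> Prop.

Definition inv_pred : {pred A} :=
  [pred a | `[< forall w, G w -> act w a = a >]].

Fact inv_pred_closed : subring_closed inv_pred.
Proof.
split=> [|a b|a b]; rewrite !inE.
- by move=> w _; rewrite rmorph1.
- by move=> ha hb w hw; rewrite rmorphB ha // hb.
- by move=> ha hb w hw; rewrite rmorphM ha // hb.
Qed.

HB.instance Definition _ :=
  GRing.isSubringClosed.Build A inv_pred inv_pred_closed.

Record invariants := Invariant {
  inv_val :> A;
  inv_valP : inv_val \in inv_pred }.

HB.instance Definition _ := [isSub of invariants for inv_val].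
HB.instance Definition _ := [Choice of invariants by <:].
HB.instance Definition _ := [SubChoice_isSubComNzRing of invariants by <:].

End Invariants.

Arguments inv_val {A T act G}.

Section InvariantsIncl.
Variables (A : comNzRingType) (T : Type) (act : T -> {rmorphism A -> A}).
Variables (G H : T -> Prop) (sHG : forall w, H w -> G w).

Fact inv_incl_subproof (a : invariants act G) : inv_val a \in inv_pred act H.
Proof.
by rewrite inE; move=> w /sHG; have := inv_valP a; rewrite inE; apply.
Qed.

Definition inv_incl (a : invariants act G) : invariants act H :=
  Invariant (inv_incl_subproof a).

End InvariantsIncl.

(* Tensor products: M (x)_A N for commutative A-algebras f : A -> M and       *)
(* g : A -> N, as the free abelian group on M * N modulo the subgroup         *)
(* generated by the usual relators.                                           *)

Section Tensor.
Variables (A M N : comNzRingType) (f : A -> M) (g : A -> N).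

Local Notation FMN := {freeg (M * N)%type}.
Local Notation gen x y := (<< (x, y) >> : FMN).

Inductive tensor_relator : FMN -> Prop :=
| TensorDl m m' n : tensor_relator (gen (m + m') n - gen m n - gen m' n)
| TensorDr m n n' : tensor_relator (gen m (n + n') - gen m n - gen m n')
| TensorBal a m n : tensor_relator (gen (f a * m) n - gen m (g a * n)).

Inductive tensor_relation : FMN -> Prop :=
| TensorRel0 : tensor_relation 0
| TensorRelB x y :
    tensor_relation x -> tensor_relation y -> tensor_relation (x - y)
| TensorRelG x : tensor_relator x -> tensor_relation x.

Definition tensor_pred : {pred FMN} := [pred x | `[< tensor_relation x >]].

Fact tensor_pred_closed : zmod_closed tensor_pred.
Proof.
split=> [|x y]; rewrite !inE; first by constructor.
by move=> hx hy; constructor.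
Qed.

HB.instance Definition _ :=
  GRing.isZmodClosed.Build FMN tensor_pred tensor_pred_closed.

Definition tensor : zmodType := Quotient.quot tensor_pred.

Definition tens (m : M) (n : N) : tensor :=
  \pi_(Quotient.quot tensor_pred) (gen m n).

(* The additive map m (x) n |-> phi m n; phi is meant to be biadditive and    *)
(* A-balanced, in which case the value does not depend on the representative  *)
(* (tensor_lift_tens, tensor_liftB).                                          *)
Definition tensor_lift (G : zmodType) (phi : M -> N -> G) (t : tensor) : G :=
  fglift (fun p : M * N => phi p.1 p.2 : zmodule G)
    (repr (t : Quotient.quot tensor_pred)).

Section TensorLift.
Variables (G : zmodType) (phi : M -> N -> G).
Hypothesis phiDl : forall m m' n, phi (m + m') n = phi m n + phi m' n.
Hypothesis phiDr : forall m n n', phi m (n + n') = phi m n + phi m n'.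
Hypothesis phi_bal : forall a m n, phi (f a * m) n = phi m (g a * n).

Let Phi : FMN -> zmodule G := fglift (fun p => phi p.1 p.2 : zmodule G).

Let PhiB x y : Phi (x - y) = Phi x - Phi y.
Proof. exact: lift_is_additive. Qed.

Let Phi_gen m n : Phi (gen m n) = phi m n.
Proof. by rewrite /Phi liftU scale1r. Qed.

Let Phi_relation x : tensor_relation x -> Phi x = 0.
Proof.
elim=> [|{}x y _ hx _ hy|{}x [m m' n|m n n'|a m n]].
- by rewrite -(subrr (0 : FMN)) PhiB subrr.
- by rewrite PhiB hx hy subrr.
- by rewrite !PhiB !Phi_gen phiDl (addrC (phi m n)) addrK subrr.
- by rewrite !PhiB !Phi_gen phiDr (addrC (phi m n)) addrK subrr.
- by rewrite PhiB !Phi_gen phi_bal subrr.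
Qed.

Let tensor_lift_pi x :
  tensor_lift phi (\pi_(Quotient.quot tensor_pred) x) = Phi x.
Proof.
apply/eqP; rewrite -subr_eq0; apply/eqP; rewrite -[LHS]PhiB.
apply: Phi_relation; apply/asboolP.
have /eqP := reprK (\pi_(Quotient.quot tensor_pred) x).
by rewrite -Quotient.idealrBE.
Qed.

Lemma tensor_lift_tens m n : tensor_lift phi (tens m n) = phi m n.
Proof. by rewrite tensor_lift_pi Phi_gen. Qed.

Lemma tensor_liftB t u :
  tensor_lift phi (t - u) = tensor_lift phi t - tensor_lift phi u.
Proof.
elim/quotW: t => x; elim/quotW: u => y.
by rewrite -[_ - _](raddfB (\pi_(Quotient.quot tensor_pred))) !tensor_lift_pi PhiB.
Qed.

End TensorLift.

End Tensor.

(* Structure algebras of labelled graphs.  A relation E x y a says that there *)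
(* is an edge from x to y with label a in the ring S; eps : S -> K is an      *)
(* augmentation.  A direct sum of copies of S over a finite set of vertices   *)
(* is represented as the ring of all functions from the vertices to S.        *)

Section Vertices.
Variables (X : choiceType) (O : X -> Prop) (x0 : X) (Ox0 : O x0).

Record vertices := Vertex { vertex_val :> X; vertexP : `[< O vertex_val >] }.

HB.instance Definition _ := [isSub of vertices for vertex_val].
HB.instance Definition _ := [Choice of vertices by <:].

Definition pointed_vertices of O x0 : Type := vertices.
HB.instance Definition _ := Choice.on (pointed_vertices Ox0).
HB.instance Definition _ :=
  isPointed.Build (pointed_vertices Ox0) (Vertex (asboolT Ox0)).

End Vertices.

Section StructureAlgebra.
Variables (V : pointedType) (S K : comNzRingType).
Variables (E : V -> V -> S -> Prop) (eps : {rmorphism S -> K}).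

Definition sa_pred : {pred V -> S} :=
  [pred z | `[< forall x y a, E x y a -> exists s, z x - z y = a * s >]].

Fact sa_pred_closed : subring_closed sa_pred.
Proof.
split=> [|z z'|z z']; rewrite !inE.
- by move=> x y a _; exists 0; rewrite subrr mulr0.
- move=> hz hz' x y a xy.
  have [s hs] := hz _ _ _ xy; have [s' hs'] := hz' _ _ _ xy.
  exists (s - s'); rewrite mulrBr -hs -hs'.
  by rewrite -[(z - z') x]/(z x - z' x) -[(z - z') y]/(z y - z' y) !opprD
    !opprK addrACA.
- move=> hz hz' x y a xy.
  have [s hs] := hz _ _ _ xy; have [s' hs'] := hz' _ _ _ xy.
  exists (s * z' x + z y * s'); rewrite mulrDr mulrA -hs mulrCA -hs'.
  by rewrite -[(z * z') x]/(z x * z' x) -[(z * z') y]/(z y * z' y) mulrBl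
    mulrBr addrA subrK.
Qed.

HB.instance Definition _ :=
  GRing.isSubringClosed.Build (V -> S) sa_pred sa_pred_closed.

Record structure_algebra := StructureAlgebra {
  sa_val :> V -> S;
  sa_valP : sa_val \in sa_pred }.

HB.instance Definition _ := [isSub of structure_algebra for sa_val].
HB.instance Definition _ := [Choice of structure_algebra by <:].
HB.instance Definition _ :=
  [SubChoice_isSubComNzRing of structure_algebra by <:].

Fact sa_const_subproof (s : S) : cst s \in sa_pred.
Proof. by rewrite inE; move=> x y a _; exists 0; rewrite subrr mulr0. Qed.

(* The structure map S -> Z of the S-algebra Z. *)
Definition sa_const (s : S) : structure_algebra :=
  StructureAlgebra (sa_const_subproof s).

Definition aug_pred : {pred structure_algebra} :=
  [pred z | `[< exists q (s : 'I_q -> S) (b : 'I_q -> structure_algebra),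
     (forall i, eps (s i) = 0) /\ z = \sum_i sa_const (s i) * b i >]].

Fact aug_pred_closed : idealr_closed aug_pred.
Proof.
split.
- by rewrite inE; exists 0%N, (fun _ => 0), (fun _ => 0); split=> [i|];
    rewrite ?rmorph0 ?big_ord0.
- rewrite inE; apply/asboolP=> -[q [s [b [hs]]]].
  move=> /(congr1 val) /(congr1 (fun z => eps (z point))).
  rewrite raddf_sum /= fct_sumE rmorph_sum rmorph1 big1 => [/eqP|i _].
    by rewrite oner_eq0.
  by rewrite -[RHS](mul0r (eps (b i point))) -(hs i) -rmorphM.
- move=> c u v; rewrite !inE => -[q [s [b [hs ->]]]].
  move=> [q' [s' [b' [hs' ->]]]].
  exists (q + q')%N.
  exists (fun i => match fintype.split i with inl i => s i | inr i => s' i end).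
  exists (fun i => match fintype.split i with inl i => c * b i | inr i => b' i end).
  split=> [i|]; first by case: fintype.split.
  rewrite big_split_ord mulr_sumr /=; congr +%R; apply: eq_bigr=> i _.
    by rewrite (unsplitK (inl i)) mulrCA.
  by rewrite (unsplitK (inr i)).
Qed.

HB.instance Definition _ :=
  isIdealr.Build structure_algebra aug_pred aug_pred_closed.

(* Z / IZ, where I = ker eps. *)
Definition reduced_sa : comNzRingType := {ideal_quot aug_pred}.

Definition sa_reduce (z : structure_algebra) : reduced_sa :=
  \pi_{ideal_quot aug_pred} z.

End StructureAlgebra.

Section MatrixGroups.
Variables (A : comUnitRingType) (N : nat).

Inductive generated (Q : set 'M[A]_N) : 'M[A]_N -> Prop :=
| Generated1 : generated Q 1%:M
| GeneratedM g w : Q g -> generated Q w -> generated Q (g *m w)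
| GeneratedV g w : Q g -> generated Q w -> generated Q (invmx g *m w).

Lemma generatedS (P Q : set 'M[A]_N) :
  P `<=` Q -> forall w, generated P w -> generated Q w.
Proof.
move=> sPQ w; elim=> [|g {}w /sPQ Qg _ IHw|g {}w /sPQ Qg _ IHw].
- exact: Generated1.
- exact: GeneratedM.
- exact: GeneratedV.
Qed.

End MatrixGroups.

Definition dot (A : pzRingType) (N : nat) (u v : 'cV[A]_N) : A :=
  (u^T *m v) 0 0.

Section Quadratic.
Variables (k : comUnitRingType) (c1 c2 : k).

Definition quad_poly : {poly k} := 'X^2 - c1 *: 'X + c2%:P.
Definition quad : comNzRingType := {poly %/ quad_poly}.

Definition quadC (a : k) : quad := qpolyC quad_poly a.
HB.instance Definition _ :=
  GRing.RMorphism.copy quadC (qpolyC quad_poly : k -> {poly %/ quad_poly}).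

Definition tau : quad := qpolyX quad_poly.
Definition sigma : quad := quadC c1 - tau.
Definition disc : k := c1 ^+ 2 - 4%:R * c2.

(* z = quadC (qre z) + tau * quadC (qim z) *)
Definition qre (z : quad) : k := (z : {poly k})`_0.
Definition qim (z : quad) : k := (z : {poly k})`_1.

Variable n : nat.

(* l^n as a k-module: the coordinates are (y_1, .., y_n, y'_1, .., y'_n). *)
Local Notation U := 'cV[k]_(n + n).

Definition to_quad (u : U) : 'cV[quad]_n :=
  \col_i (quadC (usubmx u i 0) + tau * quadC (dsubmx u i 0)).

Definition of_quad (v : 'cV[quad]_n) : U :=
  col_mx (\col_i qre (v i 0)) (\col_i qim (v i 0)).

Definition tau_op (u : U) : U := of_quad (tau *: to_quad u).

Definition B_tau (u v : U) : k := qre (dot (to_quad u) (to_quad v)).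

Definition tau_rational (u : U) : Prop :=
  u <> 0 /\ exists a : k, dot (to_quad u) (to_quad u) = quadC a.

End Quadratic.

Arguments quadC {k c1 c2}.
Arguments tau {k c1 c2}.
Arguments sigma {k c1 c2}.

Inductive folding_kind := Split | NonSplit.

Section Lstar.
Variables (k : comUnitRingType) (c1 c2 : k).

Definition lstar (c : folding_kind) : comNzRingType :=
  match c with Split => k | NonSplit => quad c1 c2 end.

Definition to_lstar (c : folding_kind) : {rmorphism k -> lstar c} :=
  match c return {rmorphism k -> lstar c} with
  | Split => idfun
  | NonSplit => @quadC k c1 c2
  end.

(* pi_star, with values in U (x)_k l_star.  In the non-split case, the        *)
(* inverse of tau - sigma is (tau - sigma) / D as (tau - sigma)^2 = D.        *)
Definition pi_star (n : nat) (c : folding_kind) :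
    'cV[k]_(n + n) -> 'cV[lstar c]_(n + n) :=
  match c return 'cV[k]_(n + n) -> 'cV[lstar c]_(n + n) with
  | Split => fun u => 2%:R^-1 *: (u + tau_op c1 c2 u)
  | NonSplit => fun u =>
      (quadC (disc c1 c2)^-1 * (tau - sigma))
        *: (map_mx quadC (tau_op c1 c2 u) - sigma *: map_mx quadC u)
  end.

Definition folding_kind_axiom (R : realType) (c : folding_kind)
    (j : lstar c -> R) : Prop :=
  match c return (lstar c -> R) -> Prop with
  | Split => fun _ => [/\ c1 = 0, c2 = -1 & (2%:R : k) \is a GRing.unit]
  | NonSplit => fun j =>
      ~ (exists g : {rmorphism quad c1 c2 -> (k * k)%type},
           bijective g /\ forall a, g (quadC a) = (a, a))
      /\ 0 < j tau
  end j.

End Lstar.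

(* The ring k, as a subring of the field R of real numbers, the polynomial    *)
(* x^2 - c1 x + c2, and the embedding of l_star in R extending that of k.     *)
Record quadratic_datum (R : realType) := QuadraticDatum {
  qk :> comUnitRingType;
  qk_real : {rmorphism qk -> R};
  qc1 : qk;
  qc2 : qk;
  qkind : folding_kind;
  ql_real : {rmorphism lstar qc1 qc2 qkind -> R};
  qk_real_inj : injective qk_real;
  qc2_unit : qc2 \is a GRing.unit;
  qdisc_unit : disc qc1 qc2 \is a GRing.unit;
  ql_real_inj : injective ql_real;
  ql_realE : forall a, ql_real (to_lstar qc1 qc2 qkind a) = qk_real a;
  qkindP : folding_kind_axiom ql_real }.

(* Here Lambda = Z^m, written as columns, and its dual is written as rows. *)

Definition pairing (m : nat) (f : 'rV[int]_m) (x : 'cV[int]_m) : int :=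
  (f *m x) 0 0.

Record root_datum (m : nat) := RootDatum {
  roots : seq 'cV[int]_m;
  coroot : 'cV[int]_m -> 'rV[int]_m;
  roots_neq0 : roots != [::];
  coroot_inj : {in roots &, injective coroot};
  roots_reduced : forall a, a \in roots -> a *+ 2 \notin roots;
  coroot_root : forall a, a \in roots -> pairing (coroot a) a = 2;
  root_refl : forall a b, a \in roots -> b \in roots ->
    b - pairing (coroot a) b *: a \in roots;
  coroot_refl : forall a b, a \in roots -> b \in roots ->
    coroot b - pairing (coroot b) a *: coroot a \in map coroot roots }.

Section RootDatum.
Variables (m : nat) (X : root_datum m) (Delta : seq 'cV[int]_m).

Definition root_lattice : set 'cV[int]_m :=
  [set x | exists c : 'cV[int]_m -> int, x = \sum_(a <- roots X) c a *: a].

Definition nonneg_comb (x : 'cV[int]_m) : Prop :=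
  exists c : 'cV[int]_m -> nat, x = \sum_(a <- Delta) a *+ c a.

Record simple_roots : Prop := SimpleRoots {
  simple_uniq : uniq Delta;
  simple_root : {subset Delta <= roots X};
  simple_free : forall c : 'cV[int]_m -> int,
    \sum_(a <- Delta) c a *: a = 0 -> {in Delta, forall a, c a = 0};
  simple_span : {in roots X, forall a, nonneg_comb a \/ nonneg_comb (- a)} }.

Definition positive_root (a : 'cV[int]_m) : Prop :=
  a \in roots X /\ nonneg_comb a.

End RootDatum.

Section Reflections.
Variables (R : realType) (Q : quadratic_datum R) (n : nat).
Local Notation U := 'cV[Q]_(n + n).
Local Notation T := (@tau_op Q (qc1 Q) (qc2 Q) n).
Local Notation real := (@qk_real R Q).

Definition coroot_form (a u : U) : R := 2%:R * real (dot a u) / real (dot a a).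

(* r is the matrix of u |-> u - a^v(u) a, an automorphism of U; note that     *)
(* a^v(u) need not be in k.                                                   *)
Definition is_reflection (a : U) (r : 'M[Q]_(n + n)) : Prop :=
  r \in unitmx /\
  forall u, map_mx real (r *m u)
    = map_mx real u - coroot_form a u *: map_mx real a.

Definition refl (a : U) : 'M[Q]_(n + n) := xget 1%:M [set r | is_reflection a r].

(* The generators of the Weyl group W_Theta; Delta is a sequence of simple    *)
(* roots and emb the inclusion of Lambda in U.                                *)
Definition weyl (m : nat) (emb : 'cV[int]_m -> U) (Delta : seq 'cV[int]_m)
    (Theta : pred 'cV[int]_m) : 'M[Q]_(n + n) -> Prop :=
  generated [set refl (emb a) | a in [set a | (a \in Delta) && Theta a]].

End Reflections.

(* emb is the inclusion of Lambda in U. *)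
Record folded_representation (R : realType) (Q : quadratic_datum R) (n m : nat)
    (X : root_datum m) (Delta : seq 'cV[int]_m) := FoldedRepresentation {
  emb : {additive 'cV[int]_m -> 'cV[Q]_(n + n)};
  Delta_rat : seq 'cV[int]_m;
  emb_inj : injective emb;
  B_tauE : forall u v, @B_tau Q (qc1 Q) (qc2 Q) n u v = dot u v;
  emb_coroot : forall a x, a \in roots X ->
    (pairing (coroot X a) x)%:~R = coroot_form (emb a) (emb x);
  emb_refl : forall a, a \in roots X -> exists r, is_reflection (emb a) r;
  tau_op_root_lattice :
    @tau_op Q (qc1 Q) (qc2 Q) n @` (emb @` root_lattice X)
      = emb @` root_lattice X;
  tau_op_lattice : forall x, exists y,
    emb y = tau_op (qc1 Q) (qc2 Q) (emb x);
  weyl_lattice : forall w x, weyl emb Delta predT w ->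
    exists y, emb y = w *m emb x;
  Delta_rat_sub : {subset Delta_rat <= Delta};
  Delta_rat_rational : forall a, a \in Delta_rat ->
    tau_rational (qc1 Q) (qc2 Q) (emb a);
  Delta_decomposition :
    let T := @tau_op Q (qc1 Q) (qc2 Q) n in
    let D := emb @` [set` Delta] in
    let D_T := D `&` [set u | T u = u] in
    let D_rat := emb @` [set` Delta_rat] in
    [/\ D = D_T `|` D_rat `|` (T @` D_rat),
        D_T `&` D_rat = set0,
        D_T `&` (T @` D_rat) = set0
      & D_rat `&` (T @` D_rat) = set0] }.

Section Folding.
Variables (R : realType) (Q : quadratic_datum R) (n m : nat).
Variables (X : root_datum m) (Delta : seq 'cV[int]_m).
Variable F : folded_representation Q n X Delta.

Local Notation N := (n + n)%N.
Local Notation U := 'cV[Q]_N.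
Local Notation T := (@tau_op Q (qc1 Q) (qc2 Q) n).
Local Notation L := (lstar (qc1 Q) (qc2 Q) (qkind Q)).
Local Notation toL := (to_lstar (qc1 Q) (qc2 Q) (qkind Q)).
Local Notation piU := (@pi_star Q (qc1 Q) (qc2 Q) n (qkind Q)).
Local Notation emb := (emb F).

Definition W (Theta : pred 'cV[int]_m) := weyl emb Delta Theta.

Lemma W_sub (Theta : pred 'cV[int]_m) w : W Theta w -> W predT w.
Proof.
by apply: generatedS => _ [a /andP[Da _] <-]; exists a => //=; rewrite Da.
Qed.

(* The roots indexing Delta_tau. *)
Definition folded_simple (a : 'cV[int]_m) : bool :=
  (a \in Delta_rat F) || (a \in Delta) && (T (emb a) == emb a).

Definition folded_refl (a : 'cV[int]_m) : 'M[Q]_N :=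
  if a \in Delta_rat F then refl (T (emb a)) *m refl (emb a)
  else refl (emb a).

(* W_tau and its parabolic subgroups, as subgroups of W. *)
Definition W_tau (Theta : pred 'cV[int]_m) : 'M[Q]_N -> Prop :=
  generated [set folded_refl a | a in [set a | folded_simple a && Theta a]].

Lemma W_tau_sub (Theta : pred 'cV[int]_m) w : W_tau Theta w -> W_tau predT w.
Proof.
by apply: generatedS => _ [a /andP[Da _] <-]; exists a => //=; rewrite Da.
Qed.

(* The l_star-linear extension of w to U (x)_k l_star. *)
Definition act_star (w : 'M[Q]_N) (v : 'cV[L]_N) : 'cV[L]_N := map_mx toL w *m v.

Definition positive_folded_root (v : 'cV[L]_N) : Prop :=
  (exists w a, [/\ W_tau predT w, folded_simple a & v = act_star w (piU (emb a))])
  /\ exists c : 'cV[int]_m -> L, (forall a, 0 <= @ql_real R Q (c a))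
       /\ v = \sum_(a <- Delta | folded_simple a) c a *: piU (emb a).

Definition preserves (Theta : seq 'cV[int]_m) : Prop :=
  let span := [set u : U | exists c : 'cV[int]_m -> Q,
                 u = \sum_(a <- Theta) c a *: emb a] in
  T @` span = span.

Definition dominant (theta : U) : Prop :=
  forall a, a \in Delta ->
    0 <= @qk_real R Q (B_tau (qc1 Q) (qc2 Q) theta (emb a)).

(* Lambda_tau is the l_star-span of pi_star(Lambda); the columns of bas are a *)
(* basis of it.                                                               *)
Definition Lambda_tau : set 'cV[L]_N :=
  [set v | exists q (c : 'I_q -> L) (x : 'I_q -> 'cV[int]_m),
     v = \sum_i c i *: piU (emb (x i))].

Definition Lambda_tau_basis (r : nat) (bas : 'M[L]_(N, r)) : Prop :=
  injective (fun c : 'cV[L]_r => bas *m c)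
  /\ Lambda_tau = range (fun c : 'cV[L]_r => bas *m c).

(* The symmetric algebras: S = k[X_1, .., X_m] for the standard basis of      *)
(* Lambda, and S_tau = l_star[X_1, .., X_r] for a given basis of Lambda_tau.  *)

Variables (r : nat) (bas : 'M[L]_(N, r)).

Definition symS : comNzRingType := {mpoly Q[m]}.
Definition symSt : comNzRingType := {mpoly L[r]}.

Definition linS (x : 'cV[int]_m) : symS := \sum_i (x i 0)%:~R *: 'X_i.

Definition linSt (v : 'cV[L]_N) : symSt :=
  \sum_i (xget 0 [set c | v = bas *m c]) i 0 *: 'X_i.

Definition constS : {rmorphism Q -> symS} := @mpolyC m Q.
Definition constSt : {rmorphism L -> symSt} := @mpolyC r L.

Definition augS : {rmorphism symS -> Q} := mcoeff 0%MM.
Definition augSt : {rmorphism symSt -> L} := mcoeff 0%MM.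

Definition act_Lambda (w : 'M[Q]_N) (x : 'cV[int]_m) : 'cV[int]_m :=
  xget 0 [set y | emb y = w *m emb x].

Definition actS (w : 'M[Q]_N) : {rmorphism symS -> symS} :=
  mmap constS (fun i => linS (act_Lambda w (delta_mx i 0))).

Definition actSt (w : 'M[Q]_N) : {rmorphism symSt -> symSt} :=
  mmap constSt (fun i => linSt (act_star w (col i bas))).

Definition piS : {rmorphism symS -> symSt} :=
  mmap (constSt \o toL) (fun i => linSt (piU (emb (delta_mx i 0)))).

Variable theta : U.

Definition mu : 'cV[L]_N := piU theta.

Definition W_orbit (x : U) : Prop := exists2 w, W predT w & x = w *m theta.

Definition W_tau_orbit (y : 'cV[L]_N) : Prop :=
  exists2 w, W_tau predT w & y = act_star w mu.

Fact W_orbit0 : W_orbit theta.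
Proof. by exists 1%:M; [exact: Generated1 | rewrite mul1mx]. Qed.

Fact W_tau_orbit0 : W_tau_orbit mu.
Proof.
by exists 1%:M; [exact: Generated1 | rewrite /act_star map_mx1 mul1mx].
Qed.

Definition orbit : pointedType := pointed_vertices W_orbit0.
Definition orbit_tau : pointedType := pointed_vertices W_tau_orbit0.

Definition edge (x y : orbit) (s : symS) : Prop :=
  exists a, [/\ positive_root X Delta a,
                vertex_val y = refl (emb a) *m vertex_val x & s = linS a].

(* R_b is the conjugate of folded_refl a by w, for b = w(pi_star a).          *)
Definition edge_tau (x y : orbit_tau) (s : symSt) : Prop :=
  exists w a, let b := act_star w (piU (emb a)) in
    [/\ W_tau predT w, folded_simple a, positive_folded_root b,
        vertex_val y
          = act_star (w *m folded_refl a *m invmx w) (vertex_val x)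
      & s = linSt b].

Definition ZG : comNzRingType := structure_algebra edge.
Definition ZGt : comNzRingType := structure_algebra edge_tau.
Definition ZGbar : comNzRingType := reduced_sa edge augS.
Definition ZGtbar : comNzRingType := reduced_sa edge_tau augSt.

Definition fG : ZG -> ZGbar := sa_reduce augS.
Definition fGt : ZGt -> ZGtbar := sa_reduce augSt.

(* Characteristic maps and Borel maps; the maps below which are described by  *)
(* their values are taken to be 0 when there is no map with these values.     *)

Variable Theta : seq 'cV[int]_m.

Definition invS (P : pred 'cV[int]_m) : comNzRingType :=
  invariants actS (W P).
Definition invSt (P : pred 'cV[int]_m) : comNzRingType :=
  invariants actSt (W_tau P).

Definition char_map (s : invS (mem Theta)) : ZG :=
  xget 0 [set z : ZG | forall w (x : orbit), W predT w ->
    vertex_val x = w *m theta -> sa_val z x = actS w (inv_val s)].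

Definition char_map_tau (s : invSt (mem Theta)) : ZGt :=
  xget 0 [set z : ZGt | forall w (y : orbit_tau), W_tau predT w ->
    vertex_val y = act_star w mu -> sa_val z y = actSt w (inv_val s)].

Definition iota_star (z : ZG) : ZGt :=
  xget 0 [set b : ZGt | forall w (y : orbit_tau) (x : orbit),
    W_tau predT w -> vertex_val y = act_star w mu ->
    vertex_val x = w *m theta -> sa_val b y = piS (sa_val z x)].

Definition iota_bar (z : ZGbar) : ZGtbar :=
  fGt (iota_star (repr (z : {ideal_quot (aug_pred (E := edge) augS)}))).

Definition pi_inv (s : invS (mem Theta)) : invSt (mem Theta) :=
  insubd (0 : invSt (mem Theta)) (piS (inv_val s)).

Definition SxS : zmodType :=
  tensor (inv_val : invS predT -> symS)
         (inv_incl (@W_sub (mem Theta)) : invS predT -> invS (mem Theta)).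
Definition kxS : zmodType :=
  tensor (augS \o (inv_val : invS predT -> symS))
         (inv_incl (@W_sub (mem Theta)) : invS predT -> invS (mem Theta)).
Definition StxSt : zmodType :=
  tensor (inv_val : invSt predT -> symSt)
         (inv_incl (@W_tau_sub (mem Theta)) : invSt predT -> invSt (mem Theta)).
Definition lxSt : zmodType :=
  tensor (augSt \o (inv_val : invSt predT -> symSt))
         (inv_incl (@W_tau_sub (mem Theta)) : invSt predT -> invSt (mem Theta)).

Definition rho : SxS -> ZG :=
  tensor_lift (fun s1 s2 => sa_const edge s1 * char_map s2).
Definition rho_tau : StxSt -> ZGt :=
  tensor_lift (fun s1 s2 => sa_const edge_tau s1 * char_map_tau s2).
Definition rho_bar : kxS -> ZGbar :=
  tensor_lift (fun a s => fG (sa_const edge (constS a)) * fG (char_map s)).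
Definition rho_tau_bar : lxSt -> ZGtbar :=
  tensor_lift
    (fun a s => fGt (sa_const edge_tau (constSt a)) * fGt (char_map_tau s)).

Definition aug_id : SxS -> kxS :=
  tensor_lift (fun s1 s2 => tens _ _ (augS s1) s2 : kxS).
Definition aug_tau_id : StxSt -> lxSt :=
  tensor_lift (fun s1 s2 => tens _ _ (augSt s1) s2 : lxSt).
Definition pi_pi : SxS -> StxSt :=
  tensor_lift (fun s1 s2 => tens _ _ (piS s1) (pi_inv s2) : StxSt).
Definition pi_bar : kxS -> lxSt :=
  tensor_lift (fun a s => tens _ _ (toL a) (pi_inv s) : lxSt).

End Folding.

(* Main.v *)
(* All the maps of the cube are determined by their values on pure tensors, so
   the six identities reduce to elementary computations once the maps given by
   their values (c, c_tau, iota_star) are known to exist.  Existence amounts to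
   (i) independence of the representative w of a vertex: the stabilizer of mu in
   W_tau fixes theta (in the non-split case pi_star is injective; in the split
   case theta and tau theta are dominant, and B(nu, w lambda) <= B(nu, lambda)
   for dominant nu, lambda), and it is W_{Theta_tau} by induction on the length,
   since w a < 0 iff w (tau a) < 0 for w in W_tau and a in Delta_rat;
   (ii) divisibility along edges: p - r_a p is divisible by a, and R_b, for
   b = w (pi_star a), is the reflection at w a, times that at w (tau a) if a is
   in Delta_rat; pi_star maps these two roots to b and to a multiple of b. *)
Require Import Defs.
From mathcomp Require Import all_boot all_order all_algebra.
From mathcomp Require Import reals.
From mathcomp Require Import generic_quotient ring_quotient qpoly.
From mathcomp Require Import boolp classical_sets.
From mathcomp.multinomials Require Import freeg mpoly.
From mathcomp Require Import ring lra zify.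
Import Defs.

Set Implicit Arguments.
Unset Strict Implicit.
Unset Printing Implicit Defensive.

Import Order.TTheory GRing.Theory Num.Theory.

Local Open Scope ring_scope.

(** * Polynomial rings and tensor products *)

(** All that is used about tau rests on [c2 = -1], which the equality of [B_tau] with the dot
    product forces. Then T is symmetric, T^2 = c1 T + 1, and tau-rationality of a says that a is
    orthogonal to T a. Hence a and T a have equal length, r_{T a} r_a is -1 on the T-stable plane
    they span and 1 on its orthogonal complement, and so W_tau commutes with T and is compatible
    with [pi_star]. The obstacle is that T need not permute the roots, since T^2 a = c1 T a + a for
    a in [Delta_rat]. The sign comparison between w a and w (T a) survives because both are roots
    and because T permutes [Delta] up to multiples, of unknown sign, of the roots in tau
    ([Delta_rat]). The induction on length then takes place in W, not in W_tau: the exchange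
    property removes r_a and r_{T a} from a word one after the other. The hypothesis that [Theta] is
    preserved enters once: T a lies in the span of [Theta], hence is orthogonal to theta, so
    W_{Theta_tau} is contained in W_Theta and [pi_star] carries invariants to invariants. *)

Lemma mpoly_alg_ind (n : nat) (R : comNzRingType) (P : {mpoly R[n]} -> Prop) :
    (forall c, P c%:MP) -> (forall i, P 'X_i) ->
    (forall p q, P p -> P q -> P (p + q)) ->
    (forall p q, P p -> P q -> P (p * q)) ->
  forall p, P p.
Proof.
move=> PC PX PD PM; elim/mpolyind => [|c mm p _ _ Pp]; first exact: (PC 0).
apply: (PD) => //; rewrite -mul_mpolyC; apply: (PM) => //.
rewrite mpolyXE_id; apply: (big_ind P) => [||i _]; [exact: (PC 1)|exact: (PM)|].
by elim: (mm i) => [|k IH]; [exact: (PC 1) | rewrite exprS; exact: PM].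
Qed.

Lemma rmorph_mpoly_ext (n : nat) (R S : comNzRingType)
    (f g : {rmorphism {mpoly R[n]} -> S}) :
    (forall c, f c%:MP = g c%:MP) -> (forall i, f 'X_i = g 'X_i) ->
  forall p, f p = g p.
Proof.
move=> fgC fgX; apply: mpoly_alg_ind => // p q hp hq.
  by rewrite !rmorphD hp hq.
by rewrite !rmorphM hp hq.
Qed.

(** Twisted Leibniz rule: f(pq) - g(pq) = (f p - g p) f q + g p (f q - g q), so the polynomials on
    which f and g agree modulo d form a subring. With f the identity and g a reflection,
    divisibility by a root is reduced to linear forms. *)
Lemma rmorph_mpoly_dvd (n : nat) (R S : comNzRingType)
    (f g : {rmorphism {mpoly R[n]} -> S}) (d : S) :
    (forall c, f c%:MP = g c%:MP) ->
    (forall i, exists s, f 'X_i - g 'X_i = d * s) ->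
  forall p, exists s, f p - g p = d * s.
Proof.
move=> fgC fgX; apply: mpoly_alg_ind => //
  [c|p q [s hs] [t ht]|p q [s hs] [t ht]].
- by exists 0; rewrite fgC subrr mulr0.
- by exists (s + t); rewrite !rmorphD mulrDr -hs -ht; ring.
- exists (s * f q + g p * t); rewrite !rmorphM.
  have -> : d * (s * f q + g p * t) = (d * s) * f q + g p * (d * t) by ring.
  by rewrite -hs -ht; ring.
Qed.

Section TensorInduction.
Variables (A M N : comNzRingType) (f : A -> M) (g : A -> N).

(** Closure under differences is the form that matches [tensor_liftB], the additivity available for
    maps out of the tensor product. *)
Lemma tensor_ind (P : tensor f g -> Prop) :
    (forall m n, P (tens f g m n)) -> (forall t u, P t -> P u -> P (t - u)) ->
  forall t, P t.
Proof.
move=> Pt PB.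
pose q := \pi_(Quotient.quot (tensor_pred f g))%qT.
have P0 : P 0 by rewrite -(subrr (tens f g 0 0)); apply: (PB).
have PN t : P t -> P (- t) by move=> ht; rewrite -sub0r; apply: (PB).
have PD t u : P t -> P u -> P (t + u).
  by move=> ht hu; rewrite -[u]opprK; apply: (PB) => //; apply: (PN).
suff Pq x : P (q x) by elim/quotW => x; exact: Pq.
rewrite -(freeg_sumE x) [q _](raddf_sum
  (\pi_(Quotient.quot (tensor_pred f g))%qT)).
apply: (big_ind P) => // -[m n] _.
have -> : << coeff (m, n) x *g (m, n) >> = << (m, n) >> *~ coeff (m, n) x.
  by rewrite freeg_mulz; congr << _ *g _ >>; rewrite intz.
rewrite (raddfMz (\pi_(Quotient.quot (tensor_pred f g))%qT)).
have Pn k : P ((q << (m, n) >> : tensor f g) *+ k).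
  by elim: k => [|k IH]; rewrite ?mulr0n // mulrS; apply: (PD) => //; exact: Pt.
by case: (coeff _ _) => k; rewrite ?NegzE ?mulrNz; [|apply: (PN)]; exact: Pn.
Qed.

Lemma tensor_eqP (x y : {freeg (M * N)%type}) : tensor_relation f g (x - y) ->
  \pi_(Quotient.quot (tensor_pred f g))%qT x
    = \pi_(Quotient.quot (tensor_pred f g))%qT y.
Proof.
move=> rxy; apply/eqP; rewrite -Quotient.idealrBE; exact/asboolP.
Qed.

Lemma tensDl m m' n : tens f g (m + m') n = tens f g m n + tens f g m' n.
Proof.
rewrite /tens -[RHS](raddfD (\pi_(Quotient.quot (tensor_pred f g))%qT)).
by apply: tensor_eqP; rewrite opprD addrA; apply: TensorRelG; exact: TensorDl.
Qed.

Lemma tensDr m n n' : tens f g m (n + n') = tens f g m n + tens f g m n'.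
Proof.
rewrite /tens -[RHS](raddfD (\pi_(Quotient.quot (tensor_pred f g))%qT)).
by apply: tensor_eqP; rewrite opprD addrA; apply: TensorRelG; exact: TensorDr.
Qed.

Lemma tens_bal a m n : tens f g (f a * m) n = tens f g m (g a * n).
Proof. by apply: tensor_eqP; apply: TensorRelG; exact: TensorBal. Qed.

End TensorInduction.

(** * Quadratic algebras and the operator tau *)

Section Quadratic.
Variables (k : comUnitRingType) (c1 c2 : k).
Local Notation l := (quad c1 c2).

Lemma quad_poly_monic_size :
  quad_poly c1 c2 \is monic /\ size (quad_poly c1 c2) = 3%N.
Proof.
have sz : (size (- (c1 *: 'X) + c2%:P)%R < size ('X^2 : {poly k})%R)%N.
  rewrite size_polyXn (leq_ltn_trans (size_polyD _ _)) // gtn_max size_polyN.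
  rewrite (leq_ltn_trans (size_scale_leq _ _)) ?size_polyX //.
  by rewrite (leq_ltn_trans (size_polyC_leq1 _)).
rewrite /quad_poly -addrA; split; last by rewrite size_polyDl // size_polyXn.
by rewrite monicE lead_coefDl // lead_coefXn.
Qed.

(** The ring [{poly %/ p}] is the quotient by [mk_monic p], which falls back on a default polynomial
    unless p is monic and nonconstant. *)
Lemma mk_quad_poly : mk_monic (quad_poly c1 c2) = quad_poly c1 c2.
Proof.
by have [qm qs] := quad_poly_monic_size; rewrite /mk_monic qs qm.
Qed.

Lemma quadCE a : quadC a = in_qpoly (quad_poly c1 c2) a%:P :> l.
Proof.
apply: val_inj => /=; rewrite Pdiv.CommonRing.rmodp_small // size_polyC.
by rewrite (leq_ltn_trans _ (size_mk_monic_gt1 _)) // leq_b1.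
Qed.

Lemma tau_sqr : (tau : l) * tau = quadC c1 * tau - quadC c2.
Proof.
have [qm qs] := quad_poly_monic_size.
have q0 : in_qpoly (quad_poly c1 c2) (quad_poly c1 c2) = 0.
  by apply: val_inj; rewrite /= mk_quad_poly Pdiv.RingMonic.rmodpp.
rewrite !quadCE /tau /qpolyX -!in_qpolyM -rmorphN -in_qpolyD.
have -> : 'X * 'X = quad_poly c1 c2 + (c1 *: 'X - c2%:P) :> {poly k}.
  by rewrite /quad_poly -!mul_polyC; ring.
by rewrite [LHS]in_qpolyD q0 add0r mul_polyC.
Qed.

Definition qpair (y y' : k) : l := quadC y + tau * quadC y'.

Lemma qpairE (y y' : k) : qpair y y' = y%:P + y' *: 'X :> {poly k}.
Proof.
have [qm qs] := quad_poly_monic_size.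
rewrite /qpair !quadCE /tau /qpolyX -in_qpolyM -in_qpolyD mulrC mul_polyC.
rewrite in_qpoly_small // mk_quad_poly qs (leq_ltn_trans (size_polyD _ _)) //.
rewrite gtn_max (leq_ltn_trans (size_polyC_leq1 _)) //.
by rewrite (leq_ltn_trans (size_scale_leq _ _)) ?size_polyX.
Qed.

Lemma qre_qpair y y' : qre (qpair y y') = y.
Proof.
by rewrite /qre qpairE coefD coefC coefZ coefX mulr0 addr0.
Qed.

Lemma qim_qpair y y' : qim (qpair y y') = y'.
Proof.
by rewrite /qim qpairE coefD coefC coefZ coefX mulr1 add0r.
Qed.

End Quadratic.

Section Dot.
Variables (A : comNzRingType) (N : nat).
Implicit Types u v w : 'cV[A]_N.

Lemma dotE u v : dot u v = \sum_i u i 0 * v i 0.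
Proof. by rewrite /dot mxE; apply: eq_bigr => i _; rewrite mxE. Qed.

Lemma dotC u v : dot u v = dot v u.
Proof. by rewrite !dotE; apply: eq_bigr => i _; rewrite mulrC. Qed.

Lemma dotDr u v w : dot u (v + w) = dot u v + dot u w.
Proof. by rewrite /dot mulmxDr mxE. Qed.

Lemma dotNr u v : dot u (- v) = - dot u v.
Proof. by rewrite /dot mulmxN mxE. Qed.

Lemma dotBr u v w : dot u (v - w) = dot u v - dot u w.
Proof. by rewrite dotDr dotNr. Qed.

Lemma dotZr a u v : dot u (a *: v) = a * dot u v.
Proof. by rewrite /dot -scalemxAr mxE. Qed.

Lemma dotDl u v w : dot (u + v) w = dot u w + dot v w.
Proof. by rewrite !(dotC _ w) dotDr. Qed.

Lemma dotNl u v : dot (- u) v = - dot u v.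
Proof. by rewrite !(dotC _ v) dotNr. Qed.

Lemma dotBl u v w : dot (u - v) w = dot u w - dot v w.
Proof. by rewrite !(dotC _ w) dotBr. Qed.

Lemma dotZl a u v : dot (a *: u) v = a * dot u v.
Proof. by rewrite !(dotC _ v) dotZr. Qed.

Lemma dot_sumr u (I : Type) (s : seq I) (F : I -> 'cV[A]_N) :
  dot u (\sum_(i <- s) F i) = \sum_(i <- s) dot u (F i).
Proof. by rewrite /dot mulmx_sumr summxE. Qed.

End Dot.

Lemma map_mx_dot (A B : comNzRingType) (f : {rmorphism A -> B}) (N : nat)
    (u v : 'cV[A]_N) : f (dot u v) = dot (map_mx f u) (map_mx f v).
Proof. by rewrite /dot map_trmx -map_mxM [RHS]mxE. Qed.

Lemma mulmx_ext (A : comNzRingType) (N p : nat) (M M' : 'M[A]_(p, N)) :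
  (forall u : 'cV_N, M *m u = M' *m u) -> M = M'.
Proof.
move=> eM; apply/matrixP => i j.
have /(congr1 (fun B : 'cV_p => B i 0)) := eM (delta_mx j 0).
by rewrite -!colE !mxE.
Qed.

(** * Multiplication by tau as a matrix, and its relation to the dot product *)

Section TauOperator.
Variables (k : comUnitRingType) (c1 c2 : k) (n : nat).
Local Notation U := 'cV[k]_(n + n).
Local Notation T := (@tau_op k c1 c2 n).
Local Notation to_l := (@to_quad k c1 c2 n).

Lemma tau_qpair y y' : tau * qpair c1 c2 y y' =
  qpair c1 c2 (- c2 * y') (y + c1 * y').
Proof.
rewrite /qpair mulrDr mulrA tau_sqr !(rmorphD, rmorphN, rmorphM); ring.
Qed.

Lemma qpairM a b c d : qpair c1 c2 a b * qpair c1 c2 c d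
  = qpair c1 c2 (a * c - c2 * (b * d)) (a * d + b * c + c1 * (b * d)).
Proof.
have -> : qpair c1 c2 a b * qpair c1 c2 c d = quadC a * quadC c
    + tau * (quadC a * quadC d + quadC b * quadC c)
    + tau * tau * (quadC b * quadC d) by rewrite /qpair; ring.
rewrite tau_sqr /qpair !(rmorphD, rmorphN, rmorphM) /=; ring.
Qed.

Lemma to_quadE u i :
  to_l u i 0 = qpair c1 c2 (u (lshift n i) 0) (u (rshift n i) 0).
Proof. by rewrite !mxE. Qed.

Lemma qpair_sum (I : Type) (s : seq I) (F G : I -> k) :
  \sum_(i <- s) qpair c1 c2 (F i) (G i)
    = qpair c1 c2 (\sum_(i <- s) F i) (\sum_(i <- s) G i).
Proof. by rewrite /qpair !rmorph_sum mulr_sumr -big_split. Qed.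

Lemma dot_to_quad u v : dot (to_l u) (to_l v) = qpair c1 c2
  (\sum_i (u (lshift n i) 0 * v (lshift n i) 0
           - c2 * (u (rshift n i) 0 * v (rshift n i) 0)))
  (\sum_i (u (lshift n i) 0 * v (rshift n i) 0
           + u (rshift n i) 0 * v (lshift n i) 0
           + c1 * (u (rshift n i) 0 * v (rshift n i) 0))).
Proof.
rewrite dotE -qpair_sum; apply: eq_bigr => i _.
by rewrite !to_quadE qpairM.
Qed.

(** Read off from tau (y + tau y') = - c2 y' + tau (y + c1 y'). *)
Definition tau_mx : 'M[k]_(n + n) := block_mx 0 (- c2)%:M 1%:M c1%:M.

Lemma tau_opE u : T u = tau_mx *m u.
Proof.
rewrite /tau_op /of_quad -[u in RHS]vsubmxK /tau_mx.
rewrite (mul_block_col 0 (- c2)%:M 1%:M) mul0mx add0r mul1mx !mul_scalar_mx.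
congr col_mx; apply/matrixP => i j; rewrite !ord1 !mxE.
  rewrite -[X in qre X]/(tau * qpair c1 c2 (u (lshift n i) 0)
    (u (rshift n i) 0)).
  by rewrite tau_qpair qre_qpair.
rewrite -[X in qim X]/(tau * qpair c1 c2 (u (lshift n i) 0) (u (rshift n i) 0)).
by rewrite tau_qpair qim_qpair.
Qed.

Lemma tau_mx_sqr : tau_mx *m tau_mx = c1 *: tau_mx - c2%:M.
Proof.
rewrite /tau_mx mulmx_block !mul0mx !mulmx0 !mul1mx !mulmx1 !add0r ?addr0.
rewrite -!scalar_mxM scale_block_mx scaler0 !scale_scalar_mx mulr1.
rewrite [c2%:M]scalar_mx_block opp_block_mx add_block_mx !oppr0 !add0r !addr0.
by rewrite [c1 * - c2]mulrC !(raddfN (@scalar_mx k n)); congr block_mx;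
  rewrite addrC.
Qed.

Lemma tau_mx_sym : c2 = -1 -> tau_mx^T = tau_mx.
Proof.
by rewrite /tau_mx => ->; rewrite tr_block_mx !tr_scalar_mx trmx0 opprK.
Qed.

Lemma dot_tau_mx u v : c2 = -1 -> dot (tau_mx *m u) v = dot u (tau_mx *m v).
Proof. by move=> /tau_mx_sym Ts; rewrite /dot trmx_mul Ts mulmxA. Qed.

(** Both forms are evaluated at a basis vector in a y'-coordinate: [B_tau] gives the constant
    coefficient - c2 of tau^2, the dot product gives 1. *)
Lemma B_tau_dot_c2 : (0 < n)%N ->
  (forall u v : U, B_tau c1 c2 u v = dot u v) -> c2 = -1.
Proof.
move=> n0 BE; pose i0 := Ordinal n0.
pose u : U := delta_mx (rshift n i0) 0.
have ul i : u (lshift n i) 0 = 0 by rewrite mxE eq_lrshift.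
have ur i : u (rshift n i) 0 = (i == i0)%:R by rewrite mxE eq_rshift andbT.
have := BE u u; rewrite /B_tau dot_to_quad qre_qpair dotE big_split_ord /=.
rewrite [X in _ = X + _]big1 => [|i _]; last by rewrite ul mul0r.
rewrite add0r (bigD1 i0) //= [X in _ + X]big1 => [|i ni]; last first.
  by rewrite ul ur (negPf ni) !mul0r mulr0 subrr.
rewrite [RHS](bigD1 i0) //= [X in _ = _ + X]big1 => [|i ni]; last first.
  by rewrite ur (negPf ni) mul0r.
by rewrite ul ur eqxx !mulr1 mul0r sub0r !addr0 => /(canRL (@opprK _)).
Qed.

(** For c2 = -1 the tau-coefficient of u_l . u_l, the sum of the 2 y y' + c1 y'^2, is exactly B(T u,
    u). *)
Lemma tau_rational_dot u : c2 = -1 ->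
  tau_rational c1 c2 u -> dot (tau_mx *m u) u = 0.
Proof.
move=> qc2E [_ [a]]; rewrite dot_to_quad => /(congr1 (@qim _ c1 c2)).
rewrite qim_qpair.
have -> : quadC a = qpair c1 c2 a 0 by rewrite /qpair rmorph0 mulr0 addr0.
rewrite qim_qpair => <-; rewrite dotE big_split_ord /= -big_split /=.
apply: eq_bigr => i _; rewrite -[u]vsubmxK /tau_mx.
rewrite (mul_block_col 0 (- c2)%:M 1%:M) mul0mx add0r mul1mx !mul_scalar_mx.
by rewrite !col_mxEu !col_mxEd !mxE qc2E; ring.
Qed.

End TauOperator.

(** * The projection [pi_star] in the split and non-split cases *)

Section PiStar.
Variables (k : comUnitRingType) (c1 c2 : k) (n : nat) (c : folding_kind).
Local Notation L := (lstar c1 c2 c).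
Local Notation toL := (to_lstar c1 c2 c).
Local Notation U := 'cV[k]_(n + n).
Local Notation TM := (tau_mx c1 c2 n).

Definition pi_mx : 'M[L]_(n + n) :=
  match c return 'M[lstar c1 c2 c]_(n + n) with
  | Split => 2%:R^-1 *: (1%:M + TM)
  | NonSplit => (quadC (disc c1 c2)^-1 * (tau - sigma))
                  *: (map_mx quadC TM - sigma%:M)
  end.

Lemma pi_starE (u : U) : pi_star c1 c2 c u = pi_mx *m map_mx toL u.
Proof.
rewrite /pi_star /pi_mx; case: c; rewrite /= tau_opE.
  by rewrite map_mx_id_in // -scalemxAl mulmxDl mul1mx.
by rewrite -scalemxAl mulmxBl map_mxM /= mul_scalar_mx.
Qed.

Lemma pi_mx_comm (w : 'M[k]_(n + n)) : w *m TM = TM *m w ->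
  map_mx toL w *m pi_mx = pi_mx *m map_mx toL w.
Proof.
rewrite /pi_mx; case: c => /= wT.
  rewrite map_mx_id_in // -scalemxAl -scalemxAr mulmxDl mulmxDr wT.
  by rewrite mul1mx mulmx1.
rewrite -scalemxAl -scalemxAr mulmxBl mulmxBr -!map_mxM wT.
by rewrite scalar_mxC.
Qed.

Definition tau_star : L :=
  match c return lstar c1 c2 c with Split => 1 | NonSplit => tau end.

(** Cayley-Hamilton: (T - sigma) T = tau (T - sigma). In the split case T^2 = 1, so 1 + T absorbs
    T. *)
Lemma pi_star_tau (u : U) : (c = Split -> c1 = 0 /\ c2 = -1) ->
  pi_star c1 c2 c (TM *m u) = tau_star *: pi_star c1 c2 c u.
Proof.
rewrite /pi_star /tau_star; case: c => /= [[//|-> ->]|_].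
  rewrite !tau_opE scale1r mulmxA tau_mx_sqr scale0r sub0r [(-1)%:M]raddfN.
  by rewrite opprK mul1mx addrC.
rewrite [RHS]scalerA [tau * _]mulrC -[RHS]scalerA; congr (_ *: _).
rewrite !tau_opE mulmxA tau_mx_sqr mulmxBl -scalemxAl mul_scalar_mx.
apply/matrixP => i j; rewrite !mxE rmorphB !rmorphM /= /sigma.
have -> a b : tau * (a - (quadC c1 - tau) * b)
    = tau * a - (quadC c1 * tau) * b + (tau * tau) * b :> quad c1 c2 by ring.
by rewrite tau_sqr; ring.
Qed.

(** Since (tau - sigma)^2 = D is a unit, the scalar in front can be cancelled. The remaining
    coordinates are (a - c1 b) + tau b with b a coordinate of u, and their tau-coefficients give u
    back. *)
Lemma pi_star_inj : disc c1 c2 \is a GRing.unit -> c = NonSplit ->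
  forall u : U, pi_star c1 c2 c u = 0 -> u = 0.
Proof.
rewrite /pi_star => dU ->/= u.
have sq : (tau - sigma) * (tau - sigma) = quadC (disc c1 c2) :> quad c1 c2.
  have -> : tau - sigma = qpair c1 c2 (- c1) 2%:R.
    by rewrite /sigma /qpair !(rmorphN, rmorph_nat); ring.
  rewrite qpairM /qpair (_ : _ + c1 * _ = 0); last by ring.
  by rewrite rmorph0 mulr0 addr0 /disc; congr quadC; ring.
move=> /(congr1 (fun v => (tau - sigma) *: v));
  rewrite scaler0 scalerA mulrCA sq.
rewrite -rmorphM mulVr // rmorph1 scale1r => /matrixP u0.
apply/matrixP => i j; have := congr1 (@qim _ c1 c2) (u0 i j).
rewrite !mxE /sigma.
have -> (a b : k) : quadC a - (quadC c1 - tau) * quadC b =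
  qpair c1 c2 (a - c1 * b) b.
  by rewrite /qpair rmorphB rmorphM; ring.
by rewrite qim_qpair /qim coef0.
Qed.

Lemma pi_star_split : (2%:R : k) \is a GRing.unit -> c = Split ->
  forall u v : U, pi_star c1 c2 c u = pi_star c1 c2 c v ->
    u + TM *m u = v + TM *m v.
Proof.
rewrite /pi_star => u2 -> u v /= uv; rewrite -!tau_opE.
have K : cancel ( *:%R (2%:R^-1 : k)) ( *:%R 2%:R : U -> U).
  by move=> x; rewrite scalerA (mulrV u2) scale1r.
exact: (can_inj K uv).
Qed.

End PiStar.

Lemma quadratic_datum_split (R : realType) (Q : quadratic_datum R) :
  qkind Q = Split -> [/\ qc1 Q = 0, qc2 Q = -1 & (2%:R : Q) \is a GRing.unit].
Proof. by move: (qkindP Q); rewrite /folding_kind_axiom; move: (ql_real Q);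
  case: (qkind Q). Qed.

(** * Roots and words in simple reflections *)

Section Roots.
Variables (m : nat) (X : root_datum m) (Delta : seq 'cV[int]_m).
Hypothesis DS : simple_roots X Delta.
Local Notation V := 'cV[int]_m.
Local Notation roots := (Defs.roots X).
Local Notation pos := (nonneg_comb Delta).
Local Notation pair a x := (pairing (coroot X a) x).
Implicit Types (a b x y : V) (c d : V -> int).

Lemma pairingB (f : 'rV[int]_m) x y :
  pairing f (x - y) = pairing f x - pairing f y.
Proof. by rewrite /pairing mulmxBr !mxE. Qed.

Lemma pairingZ (f : 'rV[int]_m) k x : pairing f (k *: x) = k * pairing f x.
Proof. by rewrite /pairing -scalemxAr mxE. Qed.

Definition root_reflection a x : V := x - pair a x *: a.
Local Notation sr := root_reflection.

Lemma root_reflectionB a x y : sr a (x - y) = sr a x - sr a y.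
Proof. by rewrite /root_reflection pairingB scalerBl !opprD !opprK addrACA. Qed.

Lemma root_reflection0 a : sr a 0 = 0.
Proof. by rewrite /root_reflection /pairing mulmx0 mxE scale0r subr0. Qed.

Lemma root_reflectionN a x : sr a (- x) = - sr a x.
Proof. by rewrite -sub0r root_reflectionB root_reflection0 sub0r. Qed.

Lemma root_reflectionZ a k x : sr a (k *: x) = k *: sr a x.
Proof. by rewrite /root_reflection pairingZ scalerBr scalerA. Qed.

Lemma root_reflection_self a : a \in roots -> sr a a = - a.
Proof.
by move=> ra; rewrite /root_reflection (coroot_root ra) -[X in X - _]scale1r
  -scalerBl scaleN1r.
Qed.

Lemma root_reflectionK a : a \in roots -> involutive (sr a).
Proof.
move=> ra x; rewrite -[X in sr a X]/(x - pair a x *: a).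
by rewrite root_reflectionB root_reflectionZ root_reflection_self // scalerN
  opprK subrK.
Qed.

Lemma root_reflection_root a x : a \in roots -> x \in roots -> sr a x \in roots.
Proof. exact: root_refl. Qed.

Lemma rootN a : a \in roots -> - a \in roots.
Proof. by move=> ra; rewrite -root_reflection_self // root_reflection_root. Qed.

Lemma root_neq0 a : a \in roots -> a != 0.
Proof.
move=> ra; apply/eqP => a0; have := coroot_root ra.
by rewrite a0 /pairing mulmx0 mxE.
Qed.

Definition comb c : V := \sum_(a <- Delta) c a *: a.

Lemma combD c d : comb c + comb d = comb (fun a => c a + d a).
Proof. by rewrite /comb -big_split; apply: eq_bigr => a _;
  rewrite scalerDl. Qed.

Lemma combN c : - comb c = comb (fun a => - c a).
Proof. by rewrite /comb -sumrN; apply: eq_bigr => a _; rewrite scaleNr. Qed.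

Lemma comb_inj c d : comb c = comb d -> {in Delta, c =1 d}.
Proof.
move/eqP; rewrite -subr_eq0 combN combD => /eqP /(simple_free DS) cd a aD.
by apply/eqP; rewrite -subr_eq0; apply/eqP; apply: cd.
Qed.

Lemma comb_simple k a : a \in Delta -> k *: a = comb (fun b => k *+ (b == a)).
Proof.
move=> aD; rewrite /comb (bigD1_seq a) ?(simple_uniq DS) //= eqxx mulr1n.
by rewrite big1 ?addr0 // => b /negPf ->; rewrite mulr0n scale0r.
Qed.

Lemma posP x : pos x <-> exists2 c, {in Delta, forall a, 0 <= c a} & x = comb c.
Proof.
split=> [[c ->]|[c c0 ->]].
  exists (fun a => (c a)%:Z) => //; apply: eq_bigr => a _.
  by rewrite -scaler_nat natz.
exists (fun a => `|c a|%N); apply: eq_big_seq => a aD.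
by rewrite -scaler_nat natz gez0_abs // c0.
Qed.

Lemma simple_pos a : a \in Delta -> pos a.
Proof.
move=> aD; apply/posP; exists (fun b => 1 *+ (b == a));
  last by rewrite -comb_simple ?scale1r.
by move=> b _; case: eqP.
Qed.

Lemma pos_neg_root x : x \in roots -> pos x -> pos (- x) -> False.
Proof.
move=> rx /posP[c c0 xc] /posP[d d0 xd]; have /eqP := root_neq0 rx; case.
have e a : a \in Delta -> c a + d a = 0.
  move=> aD; apply: (simple_free DS (c := fun a => c a + d a)) => //.
  by rewrite -[LHS]combD -xc -xd subrr.
rewrite xc; apply: big1_seq => a /andP[_ aD].
have := e a aD; have := c0 a aD; have := d0 a aD => ? ? ?.
have -> : c a = 0 by lia.
by rewrite scale0r.
Qed.

(** The reflection r_b changes only the coefficient of b. If r_b x were negative, all other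
    coefficients of x would be both nonnegative and nonpositive, and x would be a multiple of b. *)
Lemma root_reflection_simple_pos b x : b \in Delta -> x \in roots -> x != b ->
  pos x -> pos (sr b x).
Proof.
move=> bD rx xb /posP[c c0 xc]; have rb := simple_root DS bD.
have [//|/posP[d d0 yd]] := simple_span DS (root_reflection_root rb rx);
  exfalso.
have e a : a \in Delta -> c a + d a - pair b x *+ (a == b) = 0.
  move=> aD.
  apply: (simple_free DS (c := fun a => c a + d a - pair b x *+ (a == b))) =>
    //.
  rewrite -[LHS](combD (fun a => c a + d a)) -combN -comb_simple // -combD -xc
    -yd.
  by rewrite /root_reflection opprB [x + _]addrC subrK subrr.
have xE : x = c b *: b.
  rewrite xc /comb (bigD1_seq b) ?(simple_uniq DS) //= big1_seq ?addr0 //.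
  move=> a /andP[/negPf ab aD]; have := e a aD; rewrite ab mulr0n subr0.
  have := c0 a aD; have := d0 a aD => ? ? ?.
  have -> : c a = 0 by lia.
  by rewrite scale0r.
(* With x = c b, the equality 2 = x^v(x) = c x^v(b) leaves c = 1, excluded by [xb], and c = 2,
   excluded because the root datum is reduced. *)
have := coroot_root rx; rewrite {2}xE pairingZ.
have := c0 b bD; move: (pairing _ _) => k ? ck.
have [c1|c2] : c b = 1 \/ c b = 2.
  have k1 : 1 <= k by nia.
  have cb2 : c b <= 2 by nia.
  have cb0 : c b <> 0 by nia.
  by lia.
  by move: xb; rewrite xE c1 scale1r eqxx.
by have := roots_reduced rb; rewrite -scaler_nat -[2%:R]c2 -xE rx.
Qed.

Definition word_act (s : seq V) x : V := foldr sr x s.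
Local Notation act := word_act.

Lemma word_actN s x : act s (- x) = - act s x.
Proof. by elim: s => //= a s ->; rewrite root_reflectionN. Qed.

Lemma word_act_cat s t x : act (s ++ t) x = act s (act t x).
Proof. by rewrite /word_act foldr_cat. Qed.

Lemma word_act_root s x : {subset s <= Delta} -> x \in roots ->
  act s x \in roots.
Proof.
elim: s => //= a s IH sD rx; apply: root_reflection_root.
  by apply: (simple_root DS); apply: sD; rewrite mem_head.
by apply: IH => // b bs; apply: sD; rewrite inE bs orbT.
Qed.

End Roots.

(** * The positive definite form, reflections of U, and words in them *)

Section Geometry.
Variables (R : realType) (Q : quadratic_datum R) (n m : nat).
Variables (X : root_datum m) (Delta : seq 'cV[int]_m).
Hypothesis DS : simple_roots X Delta.
Variable F : folded_representation Q n X Delta.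

Local Notation N := (n + n)%N.
Local Notation V := 'cV[int]_m.
Local Notation U := 'cV[Q]_N.
Local Notation e := (emb F).
Local Notation real := (@qk_real R Q).
Local Notation roots := (Defs.roots X).
Local Notation pair a x := (pairing (coroot X a) x).
Local Notation sr := (root_reflection X).
Local Notation act := (word_act X).
Implicit Types (a b x y : V) (s : seq V) (u v : U).

(** The form is read in R, where it is positive definite and where one can divide by B(a, a). *)
Definition rdot u v : R := real (dot u v).

Lemma rdotE u v : rdot u v = dot (map_mx real u) (map_mx real v).
Proof. by rewrite /rdot map_mx_dot. Qed.

Lemma rdotC u v : rdot u v = rdot v u.
Proof. by rewrite /rdot dotC. Qed.

Lemma rdotDr u v v' : rdot u (v + v') = rdot u v + rdot u v'.
Proof. by rewrite /rdot dotDr rmorphD. Qed.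

Lemma rdotBr u v v' : rdot u (v - v') = rdot u v - rdot u v'.
Proof. by rewrite /rdot dotBr rmorphB. Qed.

Lemma rdotDl u v v' : rdot (v + v') u = rdot v u + rdot v' u.
Proof. by rewrite /rdot dotDl rmorphD. Qed.

Lemma rdotBl u v v' : rdot (v - v') u = rdot v u - rdot v' u.
Proof. by rewrite /rdot dotBl rmorphB. Qed.

Lemma rdotZl c u v : rdot (c *: u) v = real c * rdot u v.
Proof. by rewrite /rdot dotZl rmorphM. Qed.

Lemma rdotZr c u v : rdot u (c *: v) = real c * rdot u v.
Proof. by rewrite /rdot dotZr rmorphM. Qed.

Lemma rdot_ge0 u : 0 <= rdot u u.
Proof.
rewrite /rdot dotE rmorph_sum; apply: sumr_ge0 => i _.
by rewrite rmorphM -expr2 sqr_ge0.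
Qed.

Lemma rdot_eq0 u : rdot u u = 0 -> u = 0.
Proof.
rewrite /rdot dotE rmorph_sum => /eqP; rewrite psumr_eq0 => [/allP u0|i _];
  last first.
  by rewrite rmorphM -expr2 sqr_ge0.
apply/matrixP => i j; rewrite ord1 mxE; apply: (@qk_real_inj R Q).
have := u0 i (mem_index_enum _); rewrite implyTb rmorphM -expr2 sqrf_eq0.
by move/eqP ->; rewrite rmorph0.
Qed.

(** As a^v(u) may lie outside k, identities between reflections of U are checked after embedding in
    R^N. *)
Lemma map_real_inj : injective (fun u : U => map_mx real u).
Proof.
move=> u v /matrixP uv; apply/matrixP => i j.
by apply: (@qk_real_inj R Q); have := uv i j; rewrite !mxE.
Qed.

Lemma emb_root_gt0 a : a \in roots -> 0 < rdot (e a) (e a).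
Proof.
move=> ra; rewrite lt0r rdot_ge0 andbT; apply/eqP => /rdot_eq0.
rewrite -(raddf0 e) => /(@emb_inj _ _ _ _ _ _ F) a0.
by have := root_neq0 ra; rewrite a0 eqxx.
Qed.

Lemma emb_pairing a x : a \in roots ->
  (pair a x)%:~R * rdot (e a) (e a) = 2%:R * rdot (e a) (e x).
Proof.
move=> ra; rewrite (emb_coroot F x ra) /coroot_form -!/(rdot _ _).
by rewrite divfK // gt_eqF // emb_root_gt0.
Qed.

Lemma reflP a : a \in roots -> is_reflection (e a) (refl (e a)).
Proof. by move=> /(emb_refl F) [r hr]; exact: (xgetI 1%:M hr). Qed.

Lemma refl_real a u : a \in roots ->
  map_mx real (refl (e a) *m u)
    = map_mx real u - coroot_form (e a) u *: map_mx real (e a).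
Proof. by move=> /reflP [_]; apply. Qed.

Lemma coroot_formE a u : coroot_form (e a) u =
  2%:R * rdot (e a) u / rdot (e a) (e a).
Proof. by []. Qed.

Lemma rdot_refl a u v : a \in roots ->
  rdot (refl (e a) *m u) (refl (e a) *m v) = rdot u v.
Proof.
move=> ra; have := emb_root_gt0 ra; have := coroot_formE a.
rewrite !rdotE !refl_real // => cE;
  rewrite !dotBl !dotBr !dotZl !dotZr !cE !rdotE.
rewrite [dot (map_mx real u) (map_mx real (e a))]dotC.
move: (dot _ _) (dot _ _) (dot _ _) => p q r r0.
by field; rewrite gt_eqF.
Qed.

Lemma embZ k x : e (k *: x) = k%:~R *: e x.
Proof. by rewrite -[X in X *: x]intz !scaler_int (raddfMz e). Qed.

Lemma refl_emb a x : a \in roots -> refl (e a) *m e x = e (sr a x).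
Proof.
move=> ra; apply: map_real_inj; rewrite refl_real // -(emb_coroot F x ra).
rewrite /root_reflection raddfB map_mxB; congr (_ - _).
by rewrite embZ map_mxZ /= rmorph_int.
Qed.

Lemma reflK a : a \in roots -> refl (e a) *m refl (e a) = 1%:M :> 'M[Q]_N.
Proof.
move=> ra; apply: mulmx_ext => u; rewrite mul1mx -mulmxA.
apply: map_real_inj; rewrite refl_real // refl_real // !coroot_formE.
rewrite !rdotE refl_real // dotBr dotZr !coroot_formE.
have := emb_root_gt0 ra; rewrite !rdotE.
move: (dot _ _) (dot _ _) => p q q0.
rewrite -addrA -scaleNr -scalerBl.
rewrite (_ : _ - _ = 0) ?scale0r ?addr0 //.
by field; rewrite gt_eqF.
Qed.

Definition isometry (g : 'M[Q]_N) :=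
  forall u v, rdot (g *m u) (g *m v) = rdot u v.

Lemma refl_conj g a b : isometry g -> a \in roots -> b \in roots ->
  g *m e a = e b -> g *m refl (e a) = refl (e b) *m g.
Proof.
move=> gi ra rb gab; apply: mulmx_ext => u; rewrite -!mulmxA.
apply: map_real_inj; rewrite refl_real // map_mxM refl_real // mulmxBr
  -scalemxAr.
by rewrite -!map_mxM gab !coroot_formE -gab !gi.
Qed.

Lemma refl_opp a : a \in roots -> refl (e (- a)) = refl (e a) :> 'M[Q]_N.
Proof.
move=> ra; apply: mulmx_ext => u; apply: map_real_inj.
rewrite !refl_real ?rootN // !coroot_formE raddfN !rdotE map_mxN.
by rewrite !dotNl !dotNr opprK scalerN mulrN mulNr scaleNr opprK.
Qed.

(** Elements of W are handled through words; the size of a word takes the place of the length in all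
    inductions. *)
Definition word_mx s : 'M[Q]_N := foldr (fun a g => refl (e a) *m g) 1%:M s.

Lemma word_mx_cat s t : word_mx (s ++ t) = word_mx s *m word_mx t.
Proof. by elim: s => [|a s /= ->]; rewrite ?mul1mx // mulmxA. Qed.

Lemma word_mx_rcons s a : word_mx (rcons s a) = word_mx s *m refl (e a).
Proof. by rewrite -cats1 word_mx_cat /= mulmx1. Qed.

Lemma subset_cons s a (P : pred V) : {subset a :: s <= P} ->
  P a /\ {subset s <= P}.
Proof.
move=> sP; split; first by apply: sP; rewrite mem_head.
by move=> b bs; apply: sP; rewrite inE bs orbT.
Qed.

Lemma word_mx_act s x : {subset s <= roots} -> word_mx s *m e x = e (act s x).
Proof.
elim: s => [|a s IH] /=; first by rewrite mul1mx.
by move/subset_cons => [ra sr]; rewrite -mulmxA IH // refl_emb.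
Qed.

Lemma word_mx_isometry s : {subset s <= roots} -> isometry (word_mx s).
Proof.
elim: s => [|a s IH] /=; first by move=> _ u v; rewrite !mul1mx.
by move/subset_cons => [ra sr] u v; rewrite -!mulmxA rdot_refl // IH.
Qed.

End Geometry.

(** * The Weyl group *)

Section Generated.
Variables (A : comUnitRingType) (N : nat) (G : set 'M[A]_N).

Lemma invmx_involution (g : 'M[A]_N) : g *m g = 1%:M ->
  g \in unitmx /\ invmx g = g.
Proof.
move=> gg; have [gU _] := mulmx1_unit gg; split => //.
by rewrite -[LHS]mulmx1 -gg mulmxA mulVmx // mul1mx.
Qed.

Lemma generated_mul v w : generated G v -> generated G w ->
  generated G (v *m w).
Proof.
move=> Gv Gw; elim: Gv => [|g {}v Gg _ IH|g {}v Gg _ IH];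
  first by rewrite mul1mx.
  by rewrite -mulmxA; apply: GeneratedM.
by rewrite -mulmxA; apply: GeneratedV.
Qed.

Lemma generated_gen g : G g -> generated G g.
Proof. by move=> Gg; rewrite -[g]mulmx1; apply: GeneratedM => //;
  exact: Generated1. Qed.

Hypothesis G_invol : forall g, G g -> g *m g = 1%:M.

Lemma generated_ind_invol (P : 'M[A]_N -> Prop) : P 1%:M ->
    (forall g w, G g -> generated G w -> P w -> P (g *m w)) ->
  forall w, generated G w -> P w.
Proof.
move=> P1 PM w; elim=> [//|g {}w Gg Gw Pw|g {}w Gg Gw Pw]; first exact: PM.
by rewrite (invmx_involution (G_invol Gg)).2; exact: PM.
Qed.

Lemma generated_unit w : generated G w -> w \in unitmx.
Proof.
move: w; apply: generated_ind_invol => [|g w Gg _ wU]; first exact: unitmx1.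
by rewrite unitmx_mul wU (invmx_involution (G_invol Gg)).1.
Qed.

Lemma generated_inv w : generated G w -> generated G (invmx w).
Proof.
move: w; apply: generated_ind_invol => [|g w Gg Gw IH].
  by rewrite invmx1; exact: Generated1.
have [gU gI] := invmx_involution (G_invol Gg).
have -> : invmx (g *m w) = invmx w *m g.
  have wU := generated_unit Gw.
  have gwU : g *m w \in unitmx by rewrite unitmx_mul gU.
  apply: (can_inj (mulmxK gwU)); rewrite mulVmx // -mulmxA [g *m _]mulmxA.
  by rewrite (G_invol Gg) mul1mx mulVmx.
by apply: generated_mul => //; exact: generated_gen.
Qed.

End Generated.

Section Weyl.
Variables (R : realType) (Q : quadratic_datum R) (n m : nat).
Variables (X : root_datum m) (Delta : seq 'cV[int]_m).
Hypothesis DS : simple_roots X Delta.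
Variable F : folded_representation Q n X Delta.

Local Notation N := (n + n)%N.
Local Notation V := 'cV[int]_m.
Local Notation U := 'cV[Q]_N.
Local Notation e := (emb F).
Local Notation roots := (Defs.roots X).
Local Notation pos := (nonneg_comb Delta).
Local Notation pair a x := (pairing (coroot X a) x).
Local Notation sr := (root_reflection X).
Local Notation act := (word_act X).
Local Notation word_mx := (word_mx F).
Implicit Types (a b x y : V) (s : seq V) (u : U) (P : pred V).

Lemma simple_roots_sub s P : {subset s <= [pred a | (a \in Delta) && P a]} ->
  {subset s <= roots}.
Proof. by move=> sD a /sD; rewrite inE => /andP[/(simple_root DS)]. Qed.

Lemma W_gen_invol P (g : 'M[Q]_N) :
  [set refl (e a) | a in [set a | (a \in Delta) && P a]]%classic g ->
    g *m g = 1%:M.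
Proof. by move=> [a /andP[/(simple_root DS) ra _] <-]; exact: reflK. Qed.

Lemma W_wordP P (w : 'M[Q]_N) : W F P w <->
  exists2 s, {subset s <= [pred a | (a \in Delta) && P a]} & w = word_mx s.
Proof.
split=> [|[s + ->]]; last first.
  elim: s => [|a s IH] /=; first by move=> _; exact: Generated1.
  move=> /subset_cons [Pa sP]; apply: GeneratedM; last exact: IH.
  by exists a.
move: w; apply: (generated_ind_invol (@W_gen_invol P)).
  by exists [::].
move=> g w [a Pa <-] _ [s sP ->]; exists (a :: s) => // b.
by rewrite inE => /predU1P[->|/sP].
Qed.

Lemma W_predTP (w : 'M[Q]_N) : W F predT w <->
  exists2 s, {subset s <= Delta} & w = word_mx s.
Proof.
rewrite W_wordP; split=> -[s sP ->]; exists s => // a /sP; first by case/andP.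
by rewrite inE andbT.
Qed.

Lemma W_isometry P w : W F P w -> isometry w.
Proof. by move=> /W_wordP [s /simple_roots_sub sP ->];
  exact: word_mx_isometry. Qed.

Lemma W_mul P v w : W F P v -> W F P w -> W F P (v *m w).
Proof. exact: generated_mul. Qed.

Lemma W_unit P w : W F P w -> w \in unitmx.
Proof. exact: (generated_unit (@W_gen_invol P)). Qed.

Lemma W_inv P w : W F P w -> W F P (invmx w).
Proof. exact: (generated_inv (@W_gen_invol P)). Qed.

Lemma sub_roots s : {subset s <= Delta} -> {subset s <= roots}.
Proof. by move=> sD a /sD /(simple_root DS). Qed.

(** Exchange property. Going through the word from the right, a becomes negative at some letter b;
    just before, it has been mapped to b itself, so r_a can be moved to the left past that suffix,
    where it becomes r_b and cancels the letter. *)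
Lemma exchange s a : {subset s <= Delta} -> a \in Delta -> pos (- act s a) ->
  exists t, [/\ {subset t <= Delta},
    (size t < size s)%N & word_mx s *m refl (e a) = word_mx t].
Proof.
elim: s => [|b s IH] /= sD aD sa.
  by have := pos_neg_root DS (simple_root DS aD) (simple_pos DS aD) sa.
have [bD {}sD] := subset_cons sD; have ra := simple_root DS aD.
have rb := simple_root DS bD.
have rsa := word_act_root DS sD ra.
have [sap|san] := simple_span DS rsa; last first.
  have [t [tD ts te]] := IH sD aD san.
  exists (b :: t); split => //; last by rewrite /= -mulmxA te.
  by move=> c; rewrite inE => /predU1P[->|/tD].
(* The only positive root that r_b makes negative is b. *)
have sab : act s a = b.
  apply/eqP/negPn/negP => /(root_reflection_simple_pos DS bD rsa) /(_ sap) bp.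
  exact: (pos_neg_root DS (root_reflection_root rb rsa)).
exists s; split => //.
rewrite -mulmxA (refl_conj (b := b) (word_mx_isometry F (sub_roots sD))) //.
  by rewrite mulmxA reflK // mul1mx.
by rewrite word_mx_act ?sab //; exact: sub_roots.
Qed.

Lemma word_act_eq s t x : {subset s <= Delta} -> {subset t <= Delta} ->
  word_mx s = word_mx t -> act s x = act t x.
Proof.
move=> sD tD st; apply: (@emb_inj _ _ _ _ _ _ F).
by rewrite -!word_mx_act ?st //; exact: sub_roots.
Qed.

(** If the word ends in a, the part before a sends a to a negative root, as the whole word sends a
    to a positive one. By exchange the same element has a shorter word, and one descends to the
    empty word. *)
Lemma word_mx_pos_trivial s : {subset s <= Delta} ->
  {in Delta, forall a, pos (act s a)} -> word_mx s = 1%:M.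
Proof.
have [k] := ubnP (size s); elim: k s => // k IH s.
case/lastP: s => [//|s a]; rewrite size_rcons ltnS => sk sD sp.
have aD : a \in Delta by apply: sD; rewrite mem_rcons mem_head.
have {}sD' : {subset s <= Delta} by move=> b bs; apply: sD;
  rewrite mem_rcons inE bs orbT.
have [t [tD ts te]] : exists t, [/\ {subset t <= Delta}, (size t < size s)%N
    & word_mx s *m refl (e a) = word_mx t].
  apply: exchange => //; have := sp _ aD.
  rewrite -cats1 word_act_cat /= root_reflection_self ?(simple_root DS) //
    word_actN //.
rewrite word_mx_rcons te; apply: IH => // [|b bD]; first exact: ltn_trans ts sk.
by rewrite -(word_act_eq (s := rcons s a)) ?word_mx_rcons //; exact: sp.
Qed.

Definition dominant_vec u := {in Delta, forall a, 0 <= rdot u (e a)}.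

Lemma emb_comb c : e (comb Delta c) = \sum_(a <- Delta) (c a)%:~R *: e a.
Proof. by rewrite /comb raddf_sum; apply: eq_bigr => a _; rewrite embZ. Qed.

Lemma rdot_sumZ u (c : V -> int) :
  rdot u (e (comb Delta c)) = \sum_(a <- Delta) (c a)%:~R * rdot u (e a).
Proof.
rewrite emb_comb /rdot dot_sumr rmorph_sum; apply: eq_bigr => a _.
by rewrite dotZr rmorphM rmorph_int.
Qed.

Lemma dominant_pos u x : dominant_vec u -> pos x -> 0 <= rdot u (e x).
Proof.
move=> du /posP[c c0 ->]; rewrite rdot_sumZ big_seq; apply: sumr_ge0 => a aD.
by rewrite mulr_ge0 ?du // ler0z c0.
Qed.

(** For a word s followed by a: if s a is positive, then s r_a v = s v - a^v(v) s a, with a^v(v) and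
    B(u, s a) both nonnegative; if s a is negative, exchange gives a shorter word. *)
Lemma dominant_W_le u (v : U) w : dominant_vec u -> dominant_vec v ->
  W F predT w ->
  rdot u (w *m v) <= rdot u v.
Proof.
move=> du dv /W_predTP [s sD ->].
have [k] := ubnP (size s); elim: k s sD => // k IH s.
case/lastP: s => [|s a]; first by move=> _ _; rewrite mul1mx.
rewrite size_rcons ltnS => sD sk.
have aD : a \in Delta by apply: sD; rewrite mem_rcons mem_head.
have {}sD : {subset s <= Delta} by move=> b bs; apply: sD;
  rewrite mem_rcons inE bs orbT.
have ra := simple_root DS aD.
rewrite word_mx_rcons; have [sap|san] :=
  simple_span DS (word_act_root DS sD ra); last first.
  have [t [tD ts ->]] := exchange sD aD san.
  by apply: IH => //; exact: ltn_trans ts sk.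
apply: le_trans (IH s sD sk); rewrite -mulmxA !rdotE !map_mxM.
rewrite -[map_mx _ (refl _) *m _]map_mxM refl_real // mulmxBr -scalemxAr
  -!map_mxM.
rewrite word_mx_act ?dotBr ?dotZr; last exact: sub_roots.
rewrite -!rdotE lerBlDr lerDl mulr_ge0 ?dominant_pos //.
by rewrite coroot_formE divr_ge0 ?rdot_ge0 // mulr_ge0 // rdotC dv.
Qed.

(** Induction on the height. Since B(x, x) > 0 is a nonnegative combination of the B(x, a), some
    simple a has a^v(x) > 0, and r_a lowers the height of x while keeping it positive when x is not
    simple. *)
Lemma pos_root_conj_simple x : x \in roots -> pos x ->
  exists s a, [/\ {subset s <= Delta}, a \in Delta & act s a = x].
Proof.
move=> + /posP[c c0 xc].
have [k] := ubnP (absz (\sum_(a <- Delta) c a)%R);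
  elim: k x c c0 xc => // k IH x c c0 xc.
rewrite ltnS => ck rx.
have [xD|xD] := boolP (x \in Delta); first by exists [::], x.
have x0 : 0 < rdot (e x) (e x) by exact: emb_root_gt0.
have [a aD xa0] : exists2 a, a \in Delta & 0 < pair a x.
  apply: contrapT => nex; move: x0; rewrite {2}xc rdot_sumZ ltNge => /negP[].
  rewrite big_seq; apply: sumr_le0 => a aD; rewrite mulr_ge0_le0 ?ler0z ?c0 //.
  have ra := simple_root DS aD.
  rewrite leNgt; apply/negP => xa; apply: nex; exists a => //.
  rewrite -(ltr0z R) -(pmulr_lgt0 _ (emb_root_gt0 F ra)) emb_pairing //.
  by rewrite rdotC mulr_gt0.
have ra := simple_root DS aD.
have xa : x != a by apply: contra xD => /eqP ->.
have ry := root_reflection_root ra rx.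
have /posP[d d0 yd] : pos (sr a x) by apply: root_reflection_simple_pos => //;
  apply/posP; exists c.
have dE : \sum_(b <- Delta) d b = \sum_(b <- Delta) c b - pair a x.
  have -> : pair a x = \sum_(b <- Delta) pair a x *+ (b == a).
    rewrite (bigD1_seq a) ?(simple_uniq DS) //= eqxx mulr1n.
    by rewrite big1 ?addr0 // => b /negPf ->.
  rewrite -sumrB; apply: eq_big_seq => b bD.
  apply: (comb_inj DS (c := d) (d := fun b => c b - pair a x *+ (b == a))) =>
    //.
  rewrite -yd -(combD Delta c) -combN -(comb_simple DS) //.
  by rewrite -xc.
have d_ge0 : 0 <= \sum_(b <- Delta) d b by rewrite big_seq;
  apply: sumr_ge0 => b /d0.
have [|s [b [sD bD sb]]] := IH _ d d0 yd _ ry; first by lia.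
exists (a :: s), b; split => //=.
  by move=> z; rewrite inE => /predU1P[->|/sD].
by rewrite sb root_reflectionK.
Qed.

(** Edges are labelled by all positive roots, whereas W is generated by simple reflections only;
    this puts the endpoints of every edge in one orbit. *)
Lemma refl_root_W x : x \in roots -> W F predT (refl (e x)).
Proof.
suff posW y : y \in roots -> pos y -> W F predT (refl (e y)).
  move=> rx; have [px|nx] := simple_span DS rx; first exact: posW.
  by rewrite -(refl_opp F rx); apply: posW => //; exact: rootN.
move=> ry /(pos_root_conj_simple ry) [s [a [sD aD sa]]].
have ra := simple_root DS aD.
have sW : W F predT (word_mx s) by apply/W_predTP; exists s.
have := refl_conj (F := F) (b := y) (word_mx_isometry F (sub_roots sD)) ra ry.
rewrite word_mx_act ?sa; last exact: sub_roots.
move=> /(_ erefl) sE.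
have -> : refl (e y) = word_mx s *m refl (e a) *m invmx (word_mx s).
  by rewrite sE mulmxK // (W_unit sW).
apply: W_mul; last exact: W_inv.
apply: W_mul => //; apply: generated_gen; exists a => //=.
by rewrite aD.
Qed.

End Weyl.

(** * Folding *)

Section Folding.
Variables (R : realType) (Q : quadratic_datum R) (n m : nat).
Variables (X : root_datum m) (Delta : seq 'cV[int]_m).
Hypothesis DS : simple_roots X Delta.
Variable F : folded_representation Q n X Delta.

Local Notation N := (n + n)%N.
Local Notation V := 'cV[int]_m.
Local Notation U := 'cV[Q]_N.
Local Notation e := (emb F).
Local Notation real := (@qk_real R Q).
Local Notation roots := (Defs.roots X).
Local Notation pair a x := (pairing (coroot X a) x).
Local Notation sr := (root_reflection X).
Local Notation TM := (tau_mx (qc1 Q) (qc2 Q) n).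
Local Notation rat := (Delta_rat F).
Implicit Types (a b x y : V) (s : seq V) (u : U) (P : pred V).

(** A nonzero root cannot embed in the zero module. This supplies the basis vector on which c2 = -1
    is tested. *)
Lemma dim_gt0 : (0 < n)%N.
Proof.
case: (roots) (roots_neq0 X) (@root_neq0 _ X) => // a r _ /(_ a (mem_head _ _)).
rewrite lt0n; apply: contraNN => /eqP n0; apply/eqP/(@emb_inj _ _ _ _ _ _ F).
by apply/matrixP => -[i iN]; exfalso; move: iN; rewrite n0.
Qed.

Lemma qc2E : qc2 Q = -1.
Proof. exact: B_tau_dot_c2 dim_gt0 (B_tauE F). Qed.

Lemma rdot_tau u v : rdot (TM *m u) v = rdot u (TM *m v).
Proof. by rewrite /rdot dot_tau_mx // qc2E. Qed.

Lemma tau_sqrE u : TM *m (TM *m u) = qc1 Q *: (TM *m u) + u.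
Proof. by rewrite mulmxA tau_mx_sqr qc2E (raddfN (@scalar_mx Q _)) opprK mulmxDl
  -scalemxAl mul1mx. Qed.

Lemma tau_mx_inj : injective (fun u => TM *m u).
Proof.
by move=> u v uv; apply: (addrI (qc1 Q *: (TM *m u)));
  rewrite -tau_sqrE uv tau_sqrE.
Qed.

Definition tau_lattice x : V := xget 0 [set y | e y = TM *m e x]%classic.
Local Notation tl := tau_lattice.

Lemma emb_tau x : e (tl x) = TM *m e x.
Proof.
have [y hy] := tau_op_lattice F x; rewrite tau_opE in hy.
exact: (xgetI 0 (P := [set y | e y = TM *m e x]%classic) hy).
Qed.

Lemma tau_lattice_inj : injective tl.
Proof.
move=> x y /(congr1 e); rewrite !emb_tau => /tau_mx_inj.
exact: (@emb_inj _ _ _ _ _ _ F).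
Qed.

Lemma tau_latticeN x : tl (- x) = - tl x.
Proof. by apply: (@emb_inj _ _ _ _ _ _ F);
  rewrite emb_tau !raddfN /= emb_tau. Qed.

Lemma rat_Delta a : a \in rat -> a \in Delta.
Proof. exact: Delta_rat_sub. Qed.

Lemma rat_root a : a \in rat -> a \in roots.
Proof. by move=> /rat_Delta /(simple_root DS). Qed.

Lemma tau_rat_Delta a : a \in rat -> tl a \in Delta.
Proof.
move=> ra; have [DE _ _ _] := Delta_decomposition F.
have [b bD] : (emb F @` [set` Delta])%classic (TM *m e a).
  by rewrite DE; right; exists (e a); [exists a | rewrite tau_opE].
by rewrite -emb_tau => /(@emb_inj _ _ _ _ _ _ F) <-.
Qed.

Lemma Delta_cases b : b \in Delta ->
  [\/ tl b = b, b \in rat | exists2 a, a \in rat & b = tl a].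
Proof.
move=> bD; have [DE _ _ _] := Delta_decomposition F.
have : (emb F @` [set` Delta])%classic (e b) by exists b.
rewrite DE => -[[[_ /= Tb]|[a /= ra /(@emb_inj _ _ _ _ _ _ F) <-]]|[_
  [a /= ra <-]]].
- by constructor 1; apply: (@emb_inj _ _ _ _ _ _ F); rewrite emb_tau -tau_opE.
- by constructor 2.
- rewrite tau_opE -emb_tau => /(@emb_inj _ _ _ _ _ _ F) <-.
  by constructor 3; exists a.
Qed.

Lemma rat_not_fixed a : a \in rat -> tl a <> a.
Proof.
move=> ra ta; have [_ DE _ _] := Delta_decomposition F.
have : set0 (e a); last by [].
rewrite -DE; split; last by exists a.
split; first by exists a => //; exact: rat_Delta.
by rewrite /= tau_opE -emb_tau ta.
Qed.

Lemma tau_rat_not_fixed a : a \in rat -> tl (tl a) <> tl a.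
Proof. by move=> ra /tau_lattice_inj; exact: rat_not_fixed. Qed.

Lemma tau_rat_not_rat a : a \in rat -> tl a \notin rat.
Proof.
move=> ra; apply/negP => ta; have [_ _ _ DE] := Delta_decomposition F.
have : set0 (e (tl a)); last by [].
rewrite -DE; split; first by exists (tl a).
by exists (e a); [exists a | rewrite tau_opE emb_tau].
Qed.

Lemma rat_orth a : a \in rat -> rdot (e (tl a)) (e a) = 0.
Proof.
move=> /Delta_rat_rational /(tau_rational_dot qc2E).
by rewrite emb_tau /rdot => ->; rewrite rmorph0.
Qed.

(** B(T a, T a) = B(a, T^2 a) = c1 B(a, T a) + B(a, a), where the middle term vanishes by
    [rat_orth]. *)
Lemma rat_norm a : a \in rat -> rdot (e (tl a)) (e (tl a)) = rdot (e a) (e a).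
Proof.
move=> ra; have := rat_orth ra; rewrite emb_tau rdot_tau => o.
rewrite rdot_tau tau_sqrE rdotDr {1}/rdot dotZr rmorphM -/(rdot _ _).
by rewrite -rdot_tau rdotC o mulr0 add0r.
Qed.

Lemma pairing_orth a x : a \in roots -> rdot (e a) (e x) = 0 -> pair a x = 0.
Proof.
move=> ra ax; have := emb_pairing F x ra; rewrite ax mulr0 => /eqP.
by rewrite mulf_eq0 (gt_eqF (emb_root_gt0 F ra)) orbF intr_eq0 => /eqP.
Qed.

Lemma tau_rat_refl a : a \in rat -> sr (tl a) a = a /\ sr a (tl a) = tl a.
Proof.
move=> ra; have tr : tl a \in roots.
  by apply: (simple_root DS); exact: tau_rat_Delta.
rewrite /root_reflection (pairing_orth tr (rat_orth ra)).
by rewrite (pairing_orth (rat_root ra)) ?scale0r ?subr0 // rdotC rat_orth.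
Qed.

Lemma folded_refl_rat a : a \in rat ->
  folded_refl F a = refl (e (tl a)) *m refl (e a).
Proof. by move=> ra; rewrite /folded_refl ra tau_opE emb_tau. Qed.

Lemma folded_refl_fixed a : a \notin rat -> folded_refl F a = refl (e a).
Proof. by move=> /negPf ra; rewrite /folded_refl ra. Qed.

Lemma folded_simpleP a : folded_simple F a ->
  a \in Delta /\ (a \in rat \/ a \notin rat /\ tl a = a).
Proof.
rewrite /folded_simple; case: (boolP (a \in rat)) =>
  [ra _|nra /andP[aD /eqP Ta]].
  by split; [exact: rat_Delta | left].
split => //; right; split => //.
by apply: (@emb_inj _ _ _ _ _ _ F); rewrite emb_tau -tau_opE.
Qed.

Lemma tau_rat_root a : a \in rat -> tl a \in roots.
Proof. by move=> /tau_rat_Delta /(simple_root DS). Qed.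

Lemma rat_refl_comm a : a \in rat ->
  refl (e (tl a)) *m refl (e a) = refl (e a) *m refl (e (tl a)) :> 'M[Q]_N.
Proof.
move=> ra; have rr := rat_root ra; have tr := tau_rat_root ra.
apply: (refl_conj (F := F)) => //; first by move=> u v; rewrite rdot_refl.
by rewrite refl_emb // (tau_rat_refl ra).1.
Qed.

Lemma folded_refl_W a : folded_simple F a -> W F predT (folded_refl F a).
Proof.
have rW b : b \in Delta -> W F predT (refl (e b)).
  by move=> bD; apply: generated_gen; exists b => //=; rewrite bD.
move=> /folded_simpleP [aD [ra|[ra _]]].
  rewrite folded_refl_rat //; apply: W_mul; apply: rW => //;
    exact: tau_rat_Delta.
by rewrite folded_refl_fixed //; apply: rW.
Qed.

Lemma folded_refl_invol a : folded_simple F a ->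
  folded_refl F a *m folded_refl F a = 1%:M.
Proof.
move=> /folded_simpleP [/(simple_root DS) aR [ra|[ra _]]]; last first.
  by rewrite folded_refl_fixed // reflK.
have tr := tau_rat_root ra.
rewrite folded_refl_rat // {2}rat_refl_comm // mulmxA
  -[_ *m _ *m refl (e a)]mulmxA.
by rewrite reflK // mulmx1 reflK.
Qed.

(** For a in [Delta_rat], the product r_{T a} r_a is -1 on the plane of a and T a and 1 on its
    orthogonal complement; both are T-stable because T is symmetric and T^2 a = c1 T a + a. *)
Lemma folded_refl_comm a : folded_simple F a ->
  folded_refl F a *m TM = TM *m folded_refl F a.
Proof.
move=> /folded_simpleP [/(simple_root DS) aR [ra|[ra ta]]]; last first.
  rewrite folded_refl_fixed //; apply: mulmx_ext => u; rewrite -!mulmxA.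
  apply: map_real_inj; rewrite refl_real // [in RHS]map_mxM refl_real // mulmxBr
    -scalemxAr.
  rewrite -!map_mxM -emb_tau ta !coroot_formE -rdot_tau -emb_tau ta.
  by [].
have tr := tau_rat_root ra.
rewrite folded_refl_rat //; apply: mulmx_ext => u; rewrite -!mulmxA.
(* By orthogonality the second coroot does not see the first reflection, and by equality of norms
   both denominators are B(a, a). *)
have tE v : map_mx real (refl (e (tl a)) *m (refl (e a) *m v))
   = map_mx real v - (2%:R * rdot (e a) v / rdot (e a) (e a)) *: map_mx real
     (e a)
     - (2%:R * rdot (e (tl a)) v / rdot (e a) (e a)) *: map_mx real (e (tl a)).
  rewrite refl_real // refl_real // !coroot_formE rat_norm //;
    congr (_ - (_ / _) *: _).
  rewrite rdotE refl_real // dotBr dotZr -!rdotE rat_orth // mulr0 subr0.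
  by [].
apply: map_real_inj; rewrite tE [in RHS]map_mxM tE !mulmxBr -!scalemxAr
  -!map_mxM.
have -> : TM *m e (tl a) = qc1 Q *: e (tl a) + e a by rewrite emb_tau tau_sqrE.
rewrite -emb_tau -!rdot_tau -emb_tau.
have -> : TM *m e (tl a) = qc1 Q *: e (tl a) + e a by rewrite emb_tau tau_sqrE.
rewrite rdotDl rdotZl !map_mxD !map_mxZ.
move: (rdot _ _) (rdot _ _) (rdot _ _) => p q r.
by apply/matrixP => i j; rewrite !mxE; ring.
Qed.

End Folding.

(** * The group W_tau and its action on the signs of roots *)

Section FoldedWeyl.
Variables (R : realType) (Q : quadratic_datum R) (n m : nat).
Variables (X : root_datum m) (Delta : seq 'cV[int]_m).
Hypothesis DS : simple_roots X Delta.
Variable F : folded_representation Q n X Delta.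

Local Notation N := (n + n)%N.
Local Notation V := 'cV[int]_m.
Local Notation U := 'cV[Q]_N.
Local Notation e := (emb F).
Local Notation roots := (Defs.roots X).
Local Notation pos := (nonneg_comb Delta).
Local Notation pair a x := (pairing (coroot X a) x).
Local Notation act := (word_act X).
Local Notation word_mx := (word_mx F).
Local Notation L := (lstar (qc1 Q) (qc2 Q) (qkind Q)).
Local Notation piU := (@pi_star Q (qc1 Q) (qc2 Q) n (qkind Q)).
Local Notation TM := (tau_mx (qc1 Q) (qc2 Q) n).
Local Notation rat := (Delta_rat F).
Implicit Types (a b x y : V) (s : seq V) (u : U) (P : pred V).
Local Notation tl := (tau_lattice F).

Lemma W_tau_gen_invol P (g : 'M[Q]_N) :
  [set folded_refl F a | a in [set a | folded_simple F a && P a]]%classic g ->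
  g *m g = 1%:M.
Proof. by move=> [a /andP[aF _] <-]; exact: folded_refl_invol. Qed.

Lemma W_tau_gen P a : folded_simple F a -> P a -> W_tau F P (folded_refl F a).
Proof. by move=> aF Pa; apply: generated_gen; exists a => //=; rewrite aF. Qed.

Lemma W_tau_W P w : W_tau F P w -> W F predT w.
Proof.
move: w; apply: (generated_ind_invol (@W_tau_gen_invol P)) => [|g w];
  first exact: Generated1.
by move=> [a /andP[aF _] <-] _; apply: W_mul; exact: folded_refl_W.
Qed.

Lemma W_tau_comm P w : W_tau F P w -> w *m TM = TM *m w.
Proof.
move: w; apply: (generated_ind_invol (@W_tau_gen_invol P)) => [|g w].
  by rewrite mul1mx mulmx1.
move=> [a /andP[aF _] <-] _ wT.
by rewrite -mulmxA wT mulmxA (folded_refl_comm DS) // mulmxA.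
Qed.

Lemma W_tau_mul P v w : W_tau F P v -> W_tau F P w -> W_tau F P (v *m w).
Proof. exact: generated_mul. Qed.

Lemma W_tau_inv P w : W_tau F P w -> W_tau F P (invmx w).
Proof. exact: (generated_inv (@W_tau_gen_invol P)). Qed.

Lemma W_tau_unit P w : W_tau F P w -> w \in unitmx.
Proof. exact: (generated_unit (@W_tau_gen_invol P)). Qed.

Lemma pi_star_act w u : w *m TM = TM *m w -> piU (w *m u) = act_star w (piU u).
Proof.
move=> wT; rewrite /act_star !pi_starE map_mxM mulmxA.
by rewrite -(pi_mx_comm _ wT) mulmxA.
Qed.

Lemma act_starM v w (u : 'cV[L]_N) :
  act_star (v *m w) u = act_star v (act_star w u).
Proof. by rewrite /act_star map_mxM mulmxA. Qed.

Lemma tau_lattice_comb c : tl (comb Delta c) = \sum_(a <- Delta) c a *: tl a.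
Proof.
apply: (@emb_inj _ _ _ _ _ _ F).
rewrite emb_tau emb_comb mulmx_sumr raddf_sum; apply: eq_bigr => a _.
by rewrite embZ emb_tau scalemxAr.
Qed.

(* The permutation of Delta exchanging a and tau a for a in Delta_rat. *)
Definition tau_swap b : V :=
  if b \in rat then tl b else
  if tl b == b then b else xget 0 [set a | a \in rat /\ tl a = b]%classic.

Lemma tau_swap_rat a : a \in rat -> tau_swap a = tl a.
Proof. by rewrite /tau_swap => ->. Qed.

Lemma tau_swap_tau a : a \in rat -> tau_swap (tl a) = a.
Proof.
move=> ra; rewrite /tau_swap (negPf (tau_rat_not_rat ra)).
have /eqP/negPf -> := tau_rat_not_fixed ra.
case: xgetP => [a' _ [_ /tau_lattice_inj //]|/(_ a) []].
by split.
Qed.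

Lemma tau_swap_fixed b : b \in Delta -> tl b = b -> tau_swap b = b.
Proof.
rewrite /tau_swap => bD tb; case: ifP => [//|_].
by rewrite tb eqxx.
Qed.

Lemma tau_swap_Delta b : b \in Delta -> tau_swap b \in Delta.
Proof.
move=> bD; have [tb|rb|[a ra ->]] := Delta_cases F bD.
- by rewrite tau_swap_fixed.
- by rewrite tau_swap_rat // tau_rat_Delta.
- by rewrite tau_swap_tau //; exact: rat_Delta ra.
Qed.

Lemma tau_swapK : {in Delta, involutive tau_swap}.
Proof.
move=> b bD; have [tb|rb|[a ra ->]] := Delta_cases F bD.
- by rewrite !tau_swap_fixed.
- by rewrite (tau_swap_rat rb) tau_swap_tau.
- by rewrite tau_swap_tau // tau_swap_rat.
Qed.

Lemma perm_tau_swap : perm_eq (map tau_swap Delta) Delta.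
Proof.
have inj : {in Delta &, injective tau_swap} by move=> a b aD bD ab;
  rewrite -(tau_swapK aD) ab tau_swapK.
apply: uniq_perm; [by rewrite map_inj_in_uniq // (simple_uniq DS)|exact:
  (simple_uniq DS)|].
move=> b; apply/mapP/idP => [[a aD ->]|bD]; first exact: tau_swap_Delta.
by exists (tau_swap b); rewrite ?tau_swapK ?tau_swap_Delta.
Qed.

(** The relation T^2 a = c1 T a + a, doubled to have integer coefficients: c1 is only known to lie
    in k, but 2 c1 is the value of the coroot of T a on T^2 a. *)
Lemma tau_tau_lattice a : a \in rat ->
  tl (tl a) *+ 2 = a *+ 2 + pair (tl a) (tl (tl a)) *: tl a.
Proof.
move=> ra; have tr := tau_rat_root DS ra.
apply: (@emb_inj _ _ _ _ _ _ F); rewrite [in RHS](raddfD e) /= !raddfMn /= embZ.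
have t2 : e (tl (tl a)) = qc1 Q *: e (tl a) + e a.
  by rewrite !emb_tau (tau_sqrE F).
have kE : (pair (tl a) (tl (tl a)))%:~R = 2%:R * qc1 Q.
  apply: (@qk_real_inj R Q); rewrite rmorph_int rmorphM rmorph_nat.
  apply: (mulIf (lt0r_neq0 (emb_root_gt0 F tr))); rewrite emb_pairing //.
  by rewrite t2 rdotDr rdotZr rat_orth // addr0 mulrA.
by rewrite kE t2 mulrnDl addrC -scalerA scaler_nat.
Qed.

(* In the simple roots, tau has the coefficients c o tau_swap, up to a correction
   on tau (Delta_rat); hence it cannot turn positive coefficients negative. *)
Lemma tau_lattice_pos x : x \in roots -> tl x \in roots -> pos x -> pos (tl x).
Proof.
move=> rx rtx /posP[c c0 xc]; have [//|/posP[d d0 txd]] := simple_span DS rtx.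
exfalso; have /eqP := root_neq0 rx; apply.
(* The correction: 2 T b equals 2 [tau_swap b] plus [kap b] times b, with [kap b] equal to 2 c1 for
   b in tau ([Delta_rat]) and 0 for the other simple roots. *)
pose kap b := if tau_swap b \in rat then pair b (tl b) else 0.
have tE b : b \in Delta -> tl b *+ 2 = tau_swap b *+ 2 + kap b *: b.
  move=> bD; rewrite /kap; have [tb|rb|[a ra ->]] := Delta_cases F bD.
  - rewrite tau_swap_fixed //; case: ifP => [/rat_not_fixed //|_].
    by rewrite tb scale0r addr0.
  - by rewrite tau_swap_rat // (negPf (tau_rat_not_rat rb)) scale0r addr0.
  - by rewrite tau_swap_tau // ra tau_tau_lattice.
have sum0 : comb Delta (fun b => c (tau_swap b) * 2%:R + c b * kap b +
  d b * 2%:R) = 0.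
  have : tl x *+ 2 + comb Delta d *+ 2 = 0 by rewrite -txd mulNrn subrr.
  rewrite {1}xc tau_lattice_comb => <-.
  have -> : (\sum_(a <- Delta) c a *: tl a) *+ 2
      = comb Delta (fun b => c (tau_swap b) * 2%:R) +
        comb Delta (fun b => c b * kap b).
    rewrite -sumrMnl; under eq_big_seq => b bD do
      rewrite scalerMnr (tE b bD) scalerDr scalerA -scalerMnr.
    rewrite big_split /=; congr (_ + _).
    rewrite /comb -[RHS](perm_big _ perm_tau_swap) big_map.
    apply: eq_big_seq => b bD.
    by rewrite tau_swapK // -scalerA scaler_nat -scalerMnr.
  rewrite -(combD Delta (fun b => c (tau_swap b) * 2%:R + c b * kap b)).
  rewrite -(combD Delta (fun b => c (tau_swap b) * 2%:R)); congr (_ + _).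
  rewrite /comb -sumrMnl; apply: eq_bigr => b _.
  by rewrite mulrC -scalerA scaler_nat.
have cE b : b \in Delta -> c (tau_swap b) * 2%:R + c b * kap b + d b * 2%:R = 0.
  move=> bD.
  exact: (simple_free DS (c := fun b => c (tau_swap b) * 2%:R + c b * kap b +
    d b * 2%:R)).
(* Coefficients of x off [Delta_rat] vanish first, from the equations without correction. In the
   equation at tau b, for b in [Delta_rat], the correction is a multiple of the coefficient at tau
   b, hence is now zero whatever the sign of c1. *)
have swap0 b : b \in Delta -> tau_swap b \notin rat -> c (tau_swap b) = 0.
  move=> bD nb; have := cE b bD; rewrite /kap (negPf nb) mulr0 addr0.
  have := c0 _ (tau_swap_Delta bD); have := d0 _ bD; lia.
have call b : b \in Delta -> c b = 0.
  move=> bD; have [rb|nrb] := boolP (b \in rat); last first.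
    rewrite -[b]tau_swapK //; apply: swap0; first exact: tau_swap_Delta.
    by rewrite tau_swapK.
  have := cE _ (tau_rat_Delta rb); rewrite tau_swap_tau //.
  have -> : c (tl b) = 0.
    rewrite -tau_swap_rat //; apply: swap0 => //.
    by rewrite tau_swap_rat // tau_rat_not_rat.
  rewrite mul0r addr0.
  have := c0 _ bD; have := d0 _ (tau_rat_Delta rb); lia.
rewrite xc /comb big1_seq // => b /andP[_ bD].
by rewrite call // scale0r.
Qed.

(** An element of W_tau commutes with T, so s (T a) = T (s a); as both are roots, [tau_lattice_pos]
    compares their signs. *)
Lemma W_tau_pos s a : {subset s <= Delta} -> W_tau F predT (word_mx s) ->
  a \in rat ->
  pos (- act s a) <-> pos (- act s (tl a)).
Proof.
move=> sD sW ra.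
have tE : act s (tl a) = tl (act s a).
  apply: (@emb_inj _ _ _ _ _ _ F); rewrite emb_tau -!word_mx_act ?emb_tau.
  - by rewrite mulmxA (W_tau_comm sW) mulmxA.
  - exact: (sub_roots DS).
  - exact: (sub_roots DS).
have r1 := word_act_root DS sD (rat_root DS ra).
have r2 := word_act_root DS sD (tau_rat_root DS ra).
rewrite tE in r2 *.
split=> [p1|p2].
  by rewrite -tau_latticeN; apply: tau_lattice_pos;
    rewrite ?tau_latticeN ?rootN.
have [p1|//] := simple_span DS r1.
by have := pos_neg_root DS r2 (tau_lattice_pos r1 r2 p1) p2.
Qed.

(** * Stabilizers of theta and mu in W_tau *)

Section Stabilizer.
Variables (Theta : seq V) (theta : U).
Hypothesis Theta_simple : {subset Theta <= Delta}.
Hypothesis F_preserves : preserves F Theta.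
Hypothesis theta_dominant : dominant F theta.
Hypothesis theta_stabilizer : forall w, W F predT w ->
  (w *m theta = theta <-> W F (mem Theta) w).

Lemma theta_dominant_vec : dominant_vec F theta.
Proof. by move=> a aD; rewrite /rdot -(B_tauE F); exact: theta_dominant. Qed.

Lemma refl_fix_orth a u : a \in roots -> refl (e a) *m u = u <->
  rdot (e a) u = 0.
Proof.
move=> ra; have a0 := emb_root_gt0 F ra.
split=> [au|au]; last first.
  by apply: map_real_inj; rewrite refl_real // coroot_formE au mulr0 mul0r
    scale0r subr0.
have := congr1 (rdot (e a)) au; rewrite rdotE refl_real // dotBr dotZr -!rdotE
  coroot_formE.
rewrite divfK ?gt_eqF // => /eqP; rewrite -subr_eq0.
have -> (x : R) : x - 2%:R * x - x = - 2%:R * x :> R by ring.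
by rewrite mulf_eq0 oppr_eq0 pnatr_eq0 /= => /eqP.
Qed.

Lemma word_act_Theta s x : {subset s <= Theta} ->
  exists2 c : V -> int, (forall b, b \notin Theta -> c b = 0)
    & act s x = x - comb Delta c.
Proof.
elim: s => [|a s IH] /=.
  move=> _; exists (fun _ => 0) => //.
  by rewrite /comb big1 ?subr0 // => b _; rewrite scale0r.
move=> /subset_cons [aT /IH [c c0 ->]].
exists (fun b => c b + pair a (x - comb Delta c) *+ (b == a)).
  move=> b bT; rewrite c0 // add0r; case: eqP bT => // ->.
  by rewrite (aT : a \in Theta).
rewrite -(combD Delta c) -(comb_simple DS) ?opprD ?addrA //.
exact: Theta_simple.
Qed.

(** If a is orthogonal to theta, then r_a lies in W_Theta, so 2 a = a - r_a a is a combination of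
    [Theta], and a is in [Theta] because the simple roots are independent. *)
Lemma mem_Theta_orth a : a \in Delta -> (a \in Theta) = (rdot theta (e a) == 0).
Proof.
move=> aD; have ra := simple_root DS aD.
have rW : W F predT (refl (e a)) by apply: generated_gen; exists a => //=;
  rewrite aD.
apply/idP/eqP => [aT|ta].
  rewrite rdotC; apply/refl_fix_orth => //; apply/(theta_stabilizer rW).
  by apply: generated_gen; exists a => //=; rewrite aD.
have /theta_stabilizer : refl (e a) *m theta = theta.
  by apply/refl_fix_orth => //; rewrite rdotC.
move=> /(_ rW) /(W_wordP DS) [s sT sE].
have sD : {subset s <= Delta} by move=> b /sT /andP[].
have [c c0 cE] : exists2 c : V -> int, (forall b, b \notin Theta -> c b = 0)
    & act s a = a - comb Delta c.
  by apply: word_act_Theta => b /sT /andP[].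
apply/negPn/negP => /c0 ca0.
have : act s a = - a.
  apply: (@emb_inj _ _ _ _ _ _ F); rewrite -word_mx_act;
    last exact: (sub_roots DS).
  by rewrite -sE refl_emb // root_reflection_self.
rewrite cE => /(congr1 (fun z => a - z));
  rewrite subKr opprK -mulr2n -scaler_nat.
by rewrite (comb_simple DS) // => /(comb_inj DS) /(_ _ aD); rewrite ca0 eqxx.
Qed.

(** For a in [Delta_rat] the point is that T a is also orthogonal to theta: it lies in the span of
    [Theta], which T preserves. *)
Lemma folded_refl_Theta a : folded_simple F a -> a \in Theta ->
  W F (mem Theta) (folded_refl F a).
Proof.
move=> aF aT; apply/(theta_stabilizer (folded_refl_W aF)).
have [aD [ra|[nra _]]] := folded_simpleP aF; have rr := simple_root DS aD.
  rewrite folded_refl_rat // -mulmxA.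
  have -> : refl (e a) *m theta = theta.
    by apply/refl_fix_orth => //; apply/eqP; rewrite rdotC -mem_Theta_orth.
  apply/refl_fix_orth; first exact: tau_rat_root.
  (* The sequence [Theta] may repeat a, and a coefficient function on vectors then counts a with its
     multiplicity. A multiple of T a is therefore used, and the nonzero multiplicity is divided out
     in R. *)
  have : (@tau_op Q (qc1 Q) (qc2 Q) n @` [set u : U | exists c : V -> Q,
             u = \sum_(b <- Theta) c b *: e b])%classic
               (e (tl a) *+ count_mem a Theta).
    exists (e a *+ count_mem a Theta);
      last by rewrite tau_opE emb_tau (raddfMn (mulmx TM)).
    exists (fun b => (b == a)%:R).
    rewrite -sum1_count -sumrMnr big_mkcond /=; apply: eq_bigr => b _.
    by case: eqP => [->|_]; rewrite ?scale1r ?scale0r.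
  rewrite F_preserves => -[c] /(congr1 (rdot theta)).
  rewrite [RHS]/rdot dot_sumr rmorph_sum [RHS]big1_seq => [|b /andP[_ bT]].
    rewrite -scaler_nat rdotZr rmorph_nat => /eqP.
    rewrite mulf_eq0 pnatr_eq0 -leqn0 leqNgt -has_count has_pred1 aT /=.
    by rewrite rdotC => /eqP.
  rewrite dotZr rmorphM -/(rdot _ _).
  have bD := Theta_simple bT.
  by move: bT; rewrite mem_Theta_orth // => /eqP ->; rewrite mulr0.
by rewrite folded_refl_fixed //; apply/refl_fix_orth => //; apply/eqP;
   rewrite rdotC -mem_Theta_orth.
Qed.

Lemma W_tau_Theta_W w : W_tau F (mem Theta) w -> W F (mem Theta) w.
Proof.
move: w; apply: (generated_ind_invol (@W_tau_gen_invol _)) => [|g w];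
  first exact: Generated1.
by move=> [a /andP[aF aT] <-] _; apply: W_mul; exact: folded_refl_Theta.
Qed.

Lemma W_tau_stabilizer w : W_tau F predT w -> w *m theta = theta ->
  W_tau F (mem Theta) w.
Proof.
move=> wW; have /(W_predTP DS) [s sD wE] := W_tau_W wW; rewrite {w}wE in wW *.
have [k] := ubnP (size s); elim: k s sD wW => // k IH s sD wW.
rewrite ltnS => sk sth.
have [sp|] := pselect {in Delta, forall a, pos (act s a)}.
  by rewrite (word_mx_pos_trivial DS) //; exact: Generated1.
move=> /existsNP [b /not_implyP [bD nb]].
(* As s fixes theta, B(theta, b') = B(theta, s b'), which is nonpositive if s b' is negative and
   nonnegative by dominance. *)
have negb b' : b' \in Delta -> pos (- act s b') -> rdot theta (e b') = 0.
  move=> b'D b'n; apply/eqP; rewrite eq_le theta_dominant_vec // andbT.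
  rewrite -(word_mx_isometry F (sub_roots DS sD)) sth word_mx_act;
    last exact: (sub_roots DS).
  rewrite -oppr_ge0 /rdot -rmorphN -dotNr -raddfN.
  exact: (dominant_pos theta_dominant_vec).
have bn : pos (- act s b).
  by have [|] := simple_span DS (word_act_root DS sD (simple_root DS bD)).
(* If the simple root made negative is tau a with a in [Delta_rat], then a is made negative too, and
   a indexes a generator of W_tau. *)
have [a aF an] : exists2 a, folded_simple F a & pos (- act s a).
  have [tb|rb|[a ra ba]] := Delta_cases F bD.
  - exists b => //; rewrite /folded_simple bD tau_opE -emb_tau tb eqxx.
    by rewrite orbT.
  - by exists b => //; rewrite /folded_simple rb.
  - exists a; first by rewrite /folded_simple ra.
    by apply/(W_tau_pos sD wW ra); rewrite -ba.
have [aD raP] := folded_simpleP aF; have rr := simple_root DS aD.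
have [t [tD ts te]] := exchange DS F sD aD an.
suff [fth [t' [t'D t's t'e]]] : folded_refl F a *m theta = theta /\
    exists t', [/\ {subset t' <= Delta}, (size t' < size s)%N
      & word_mx s *m folded_refl F a = word_mx t'].
  have aT : a \in Theta by rewrite mem_Theta_orth // negb.
  have -> : word_mx s = word_mx t' *m folded_refl F a.
    by rewrite -t'e -mulmxA (folded_refl_invol DS) // mulmx1.
  apply: W_tau_mul; last exact: W_tau_gen.
  apply: IH => //; first by rewrite -t'e; apply: W_tau_mul => //;
    exact: W_tau_gen.
    exact: leq_trans sk.
  by rewrite -t'e -mulmxA fth.
have ath : refl (e a) *m theta = theta by apply/refl_fix_orth;
  rewrite // rdotC negb.
case: raP => [ra|[nra _]]; last first.
  by rewrite folded_refl_fixed //; split => //; exists t.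
have tan : pos (- act s (tl a)) by apply/(W_tau_pos sD wW ra).
(* The reflection r_a fixes T a, so T a is still negative after the first exchange and a second one
   removes r_{T a}. *)
have tn : pos (- act t (tl a)).
  have -> // : act t (tl a) = act s (tl a).
  apply: (@emb_inj _ _ _ _ _ _ F); rewrite -!word_mx_act;
    try exact: (sub_roots DS).
  by rewrite -te -mulmxA refl_emb // (tau_rat_refl DS ra).2.
rewrite folded_refl_rat //; split.
  rewrite -mulmxA ath; apply/refl_fix_orth; first exact: tau_rat_root.
  by rewrite rdotC negb // tau_rat_Delta.
have [t' [t'D t't t'e]] := exchange DS F tD (tau_rat_Delta ra) tn.
exists t'; split => //; first exact: ltn_trans ts.
by rewrite (rat_refl_comm DS) // mulmxA te.
Qed.

(* In the split case, w mu = mu means w theta + w (tau theta) = theta + tau theta,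
   and B(theta, -) does not increase under w on either summand. *)
Lemma mu_stabilizer w : W_tau F predT w -> act_star w (piU theta) = piU theta ->
  w *m theta = theta.
Proof.
move=> wW; have wT := W_tau_comm wW; rewrite -pi_star_act //.
have wWW := W_tau_W wW.
case kE : (qkind Q); last first.
  rewrite -kE => /eqP; rewrite -subr_eq0 !pi_starE -mulmxBr -map_mxB -pi_starE
    => /eqP.
  by move=> /(pi_star_inj (qdisc_unit Q) kE) /eqP; rewrite subr_eq0 => /eqP.
have [c10 c2m u2] := @quadratic_datum_split R Q kE; rewrite -kE.
move=> /(pi_star_split u2 kE) sumE.
(* In the split case T^2 = 1, so T permutes [Delta], and being symmetric it preserves dominance. *)
have tdom : dominant_vec F (TM *m theta).
  move=> a aD; rewrite (rdot_tau F) -emb_tau; apply: theta_dominant_vec.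
  have [->//|ra|[b rb ->]] := Delta_cases F aD; first exact: tau_rat_Delta.
  have -> : tl (tl b) = b; last exact: rat_Delta rb.
  apply: (@emb_inj _ _ _ _ _ _ F).
  by rewrite !emb_tau (tau_sqrE F) c10 scale0r add0r.
have le1 := dominant_W_le DS theta_dominant_vec theta_dominant_vec wWW.
have le2 := dominant_W_le DS theta_dominant_vec tdom wWW.
have := congr1 (rdot theta) sumE; rewrite !rdotDr mulmxA -wT -mulmxA => eq12.
(* The two inequalities add up to the equality [eq12], so each is an equality; then |w theta -
   theta|^2 = 0 because w is an isometry. *)
have eq1 : rdot theta (w *m theta) = rdot theta theta by lra.
apply/eqP; rewrite -subr_eq0; apply/eqP/rdot_eq0.
rewrite rdotBl !rdotBr (W_isometry DS wWW) [rdot (w *m _) _]rdotC eq1.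
by rewrite subrr.
Qed.

End Stabilizer.

End FoldedWeyl.

(** * Actions on symmetric algebras *)

Section Algebras.
Variables (R : realType) (Q : quadratic_datum R) (n m : nat).
Variables (X : root_datum m) (Delta : seq 'cV[int]_m).
Hypothesis DS : simple_roots X Delta.
Variable F : folded_representation Q n X Delta.

Local Notation N := (n + n)%N.
Local Notation V := 'cV[int]_m.
Local Notation U := 'cV[Q]_N.
Local Notation e := (emb F).
Local Notation roots := (Defs.roots X).
Local Notation pair a x := (pairing (coroot X a) x).
Local Notation sr := (root_reflection X).
Local Notation L := (lstar (qc1 Q) (qc2 Q) (qkind Q)).
Local Notation toL := (to_lstar (qc1 Q) (qc2 Q) (qkind Q)).
Local Notation piU := (@pi_star Q (qc1 Q) (qc2 Q) n (qkind Q)).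
Implicit Types (a b x y : V) (u : U) (P : pred V).
Local Notation tl := (tau_lattice F).

Lemma linSB x y : linS Q (x - y) = linS Q x - linS Q y.
Proof.
rewrite /linS -sumrB; apply: eq_bigr => i _.
by rewrite !mxE rmorphB scalerBl.
Qed.

Lemma linSZ k x : linS Q (k *: x) = linS Q x * (k%:~R : Q)%:MP.
Proof.
rewrite /linS mulr_suml; apply: eq_bigr => i _.
by rewrite !mxE [RHS]mulrC mul_mpolyC scalerA -intrM.
Qed.

Lemma linS_sum (I : Type) (l : seq I) (f : I -> V) :
  linS Q (\sum_(i <- l) f i) = \sum_(i <- l) linS Q (f i).
Proof.
have l0 : linS Q (0 : V) = 0 by rewrite -[X in linS Q X](subrr 0) linSB subrr.
have lN x : linS Q (- x) = - linS Q x by rewrite -[- x]sub0r linSB l0 sub0r.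
elim: l => [|i l IH]; first by rewrite !big_nil.
by rewrite !big_cons -IH -[LHS]opprK -lN opprD linSB lN -opprD opprK.
Qed.

Lemma linS_delta (i : 'I_m) : linS Q (delta_mx i 0) = 'X_i.
Proof.
rewrite /linS (bigD1 i) //= mxE !eqxx scale1r big1 ?addr0 // => j ji.
by rewrite mxE (negPf ji) scale0r.
Qed.

Lemma actSC w (c : Q) : actS F w c%:MP = c%:MP.
Proof. by rewrite /actS /= mmapC. Qed.

Lemma actSX w (i : 'I_m) : actS F w 'X_i =
  linS Q (act_Lambda F w (delta_mx i 0)).
Proof. by rewrite /actS /= mmapX mmap1U. Qed.

Lemma act_LambdaE w x : W F predT w -> e (act_Lambda F w x) = w *m e x.
Proof.
move=> wW; have [y hy] := weyl_lattice x wW.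
exact: (xgetI 0 (P := [set y | e y = w *m e x]%classic) hy).
Qed.

Lemma actS_lin w x : W F predT w ->
  actS F w (linS Q x) = linS Q (act_Lambda F w x).
Proof.
move=> wW; rewrite {1}/linS rmorph_sum /=.
have xE : x = \sum_i x i 0 *: delta_mx i 0.
  by rewrite [LHS]matrix_sum_delta; apply: eq_bigr => i _; rewrite big_ord1.
have -> : act_Lambda F w x = \sum_i x i 0 *: act_Lambda F w (delta_mx i 0).
  apply: (@emb_inj _ _ _ _ _ _ F); rewrite act_LambdaE // raddf_sum /=.
  rewrite {1}xE raddf_sum mulmx_sumr; apply: eq_bigr => i _.
  by rewrite !embZ act_LambdaE // scalemxAr.
rewrite linS_sum; apply: eq_bigr => i _.
by rewrite mmapZ mmapX mmap1U linSZ mulrC.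
Qed.

Lemma act_LambdaM v w x : W F predT v -> W F predT w ->
  act_Lambda F (v *m w) x = act_Lambda F v (act_Lambda F w x).
Proof.
move=> vW wW; apply: (@emb_inj _ _ _ _ _ _ F).
by rewrite !act_LambdaE ?mulmxA //; exact: W_mul.
Qed.

Lemma actSM v w p : W F predT v -> W F predT w ->
  actS F (v *m w) p = actS F v (actS F w p).
Proof.
move=> vW wW; apply: (rmorph_mpoly_ext (f := actS F (v *m w))
  (g := actS F v \o actS F w)).
  by move=> c; rewrite /= !actSC.
by move=> i; rewrite /= !actSX actS_lin // act_LambdaM.
Qed.

Lemma actS_refl_dvd a p : a \in roots ->
  exists s, p - actS F (refl (e a)) p = linS Q a * s.
Proof.
move=> ra; have rW := refl_root_W DS F ra.
apply: (rmorph_mpoly_dvd (f := idfun) (g := actS F (refl (e a)))) => [c|i] /=.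
  by rewrite actSC.
have aE : act_Lambda F (refl (e a)) (delta_mx i 0) = sr a (delta_mx i 0).
  by apply: (@emb_inj _ _ _ _ _ _ F); rewrite act_LambdaE // refl_emb.
rewrite -[mmap _ _ _]/(actS F _ _) actSX aE -linS_delta -linSB /root_reflection
  subKr linSZ.
by eexists.
Qed.

Variables (r : nat) (bas : 'M[L]_(N, r)).
Hypothesis bas_basis : Lambda_tau_basis F bas.

(** The coordinates used by [linSt] default to 0 outside the span of [bas], so its linearity is
    asserted only for vectors of this span. *)
Definition in_Lambda_tau (v : 'cV[L]_N) := exists c : 'cV[L]_r, v = bas *m c.

Lemma linSt_bas c : linSt bas (bas *m c) = \sum_i c i 0 *: 'X_i.
Proof.
rewrite /linSt; have -> // : xget 0 [set c' | bas *m c = bas *m c']%classic = c.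
case: xgetP => [c' _ /= /(bas_basis.1) //|/(_ c) []].
by [].
Qed.

Lemma linStB v v' : in_Lambda_tau v -> in_Lambda_tau v' ->
  linSt bas (v - v') = linSt bas v - linSt bas v'.
Proof.
move=> [c ->] [c' ->]; rewrite -mulmxBr !linSt_bas -sumrB;
  apply: eq_bigr => i _.
by rewrite !mxE scalerBl.
Qed.

Lemma linStZ t v : in_Lambda_tau v -> linSt bas (t *: v) = linSt bas v * t%:MP.
Proof.
move=> [c ->]; rewrite scalemxAr !linSt_bas mulr_suml; apply: eq_bigr => i _.
by rewrite !mxE [RHS]mulrC mul_mpolyC scalerA.
Qed.

Lemma in_Lambda_tau_sum (I : Type) (l : seq I) (f : I -> 'cV[L]_N) :
  (forall i, in_Lambda_tau (f i)) -> in_Lambda_tau (\sum_(i <- l) f i).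
Proof.
move=> fL; apply: (big_ind in_Lambda_tau) => //.
  by exists 0; rewrite mulmx0.
by move=> _ _ [c ->] [c' ->]; exists (c + c'); rewrite mulmxDr.
Qed.

Lemma in_Lambda_tauZ t v : in_Lambda_tau v -> in_Lambda_tau (t *: v).
Proof. by move=> [c ->]; exists (t *: c); rewrite scalemxAr. Qed.

Lemma linStN v : in_Lambda_tau v -> linSt bas (- v) = - linSt bas v.
Proof. by move=> vL; rewrite -scaleN1r linStZ // mpolyCN mulrN mulr1. Qed.

Lemma linSt_sum (I : Type) (l : seq I) (f : I -> 'cV[L]_N) :
  (forall i, in_Lambda_tau (f i)) ->
  linSt bas (\sum_(i <- l) f i) = \sum_(i <- l) linSt bas (f i).
Proof.
move=> fL; elim: l => [|i l IH].
  by rewrite !big_nil -(mulmx0 _ bas) linSt_bas big1 // => i _;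
    rewrite mxE scale0r.
rewrite !big_cons -IH -[\sum_(_ <- _) _ in LHS]opprK linStB //; last first.
  by rewrite -scaleN1r; apply: in_Lambda_tauZ; exact: in_Lambda_tau_sum.
by rewrite linStN ?opprK //; exact: in_Lambda_tau_sum.
Qed.

Lemma in_Lambda_tauP v : in_Lambda_tau v <-> Lambda_tau F v.
Proof.
rewrite bas_basis.2; split=> [[c ->]|[c _ <-]]; first by exists c.
by exists c.
Qed.

Lemma pi_in_Lambda_tau x : in_Lambda_tau (piU (e x)).
Proof.
apply/in_Lambda_tauP; exists 1%N, (fun _ => 1), (fun _ => x).
by rewrite big_ord1 scale1r.
Qed.

Lemma act_in_Lambda_tau w v : W_tau F predT w -> in_Lambda_tau v ->
  in_Lambda_tau (act_star w v).
Proof.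
move=> wW /in_Lambda_tauP [q [c [x ->]]]; rewrite /act_star mulmx_sumr.
apply: in_Lambda_tau_sum => i; rewrite -scalemxAr; apply: in_Lambda_tauZ.
rewrite -[_ *m _]/(act_star w _) -pi_star_act ?(W_tau_comm DS wW) //.
rewrite -act_LambdaE; last exact: (W_tau_W DS wW).
exact: pi_in_Lambda_tau.
Qed.

Lemma col_in_Lambda_tau i : in_Lambda_tau (col i bas).
Proof. by exists (delta_mx i 0); rewrite colE. Qed.

Lemma linSt_col i : linSt bas (col i bas) = 'X_i.
Proof.
rewrite colE linSt_bas (bigD1 i) //= mxE !eqxx scale1r big1 ?addr0 // => j ji.
by rewrite mxE (negPf ji) scale0r.
Qed.

Lemma actStC w (c : L) : actSt bas w c%:MP = c%:MP.
Proof. by rewrite /actSt /= mmapC. Qed.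

Lemma actStX w i : actSt bas w 'X_i = linSt bas (act_star w (col i bas)).
Proof. by rewrite /actSt /= mmapX mmap1U. Qed.

Lemma actSt_lin w v : W_tau F predT w -> in_Lambda_tau v ->
  actSt bas w (linSt bas v) = linSt bas (act_star w v).
Proof.
move=> wW [c ->]; rewrite linSt_bas rmorph_sum /=.
have -> : act_star w (bas *m c) = \sum_i c i 0 *: act_star w (col i bas).
  rewrite /act_star; under eq_bigr => i _ do rewrite scalemxAr.
  rewrite -mulmx_sumr; congr (_ *m _); apply/matrixP => i j;
    rewrite ord1 mxE summxE.
  by apply: eq_bigr => k _; rewrite !mxE mulrC.
have cL i : in_Lambda_tau (act_star w (col i bas)).
  by apply: act_in_Lambda_tau => //; exact: col_in_Lambda_tau.
rewrite linSt_sum => [|i]; last exact: in_Lambda_tauZ.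
apply: eq_bigr => i _; rewrite linStZ //.
by rewrite mmapZ mmapX mmap1U mulrC.
Qed.

Lemma actStM v w p : W_tau F predT v -> W_tau F predT w ->
  actSt bas (v *m w) p = actSt bas v (actSt bas w p).
Proof.
move=> vW wW.
apply: (rmorph_mpoly_ext (f := actSt bas (v *m w))
  (g := actSt bas v \o actSt bas w)).
  by move=> c; rewrite /= !actStC.
move=> i; rewrite /= !actStX act_starM actSt_lin //.
by apply: act_in_Lambda_tau => //; exact: col_in_Lambda_tau.
Qed.

Lemma piSC (c : Q) : piS F bas c%:MP = (toL c)%:MP.
Proof. by rewrite /piS /= mmapC. Qed.

Lemma piSX i : piS F bas 'X_i = linSt bas (piU (e (delta_mx i 0))).
Proof. by rewrite /piS /= mmapX mmap1U. Qed.

Lemma piS_lin x : piS F bas (linS Q x) = linSt bas (piU (e x)).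
Proof.
have xE : x = \sum_i x i 0 *: delta_mx i 0.
  by rewrite [LHS]matrix_sum_delta; apply: eq_bigr => i _; rewrite big_ord1.
have -> : piU (e x) = \sum_i ((x i 0)%:~R : L) *: piU (e (delta_mx i 0)).
  rewrite [in LHS]xE raddf_sum pi_starE raddf_sum mulmx_sumr;
    apply: eq_bigr => i _.
  by rewrite /= embZ map_mxZ -scalemxAr -pi_starE rmorph_int.
rewrite linSt_sum => [|i]; last by apply: in_Lambda_tauZ;
  exact: pi_in_Lambda_tau.
rewrite /linS rmorph_sum; apply: eq_bigr => i _.
rewrite linStZ; last exact: pi_in_Lambda_tau.
by rewrite -mul_mpolyC rmorphM piSC piSX rmorph_int mulrC.
Qed.

Lemma piS_act w p : W_tau F predT w ->
  piS F bas (actS F w p) = actSt bas w (piS F bas p).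
Proof.
move=> wW; have wWW := W_tau_W DS wW.
apply: (rmorph_mpoly_ext (f := piS F bas \o actS F w)
  (g := actSt bas w \o piS F bas)).
  by move=> c; rewrite /= actSC piSC actStC.
move=> i; rewrite /= actSX piSX piS_lin act_LambdaE // actSt_lin //.
  by rewrite pi_star_act // (W_tau_comm DS wW).
exact: pi_in_Lambda_tau.
Qed.

Lemma aug_linSt v : augSt Q r (linSt bas v) = 0.
Proof.
rewrite /linSt rmorph_sum big1 // => i _.
by rewrite /= mcoeffZ mcoeffX mnm1_eq0 mulr0.
Qed.

Lemma aug_piS p : augSt Q r (piS F bas p) = toL (augS Q m p).
Proof.
apply: (rmorph_mpoly_ext (f := augSt Q r \o piS F bas) (g := toL \o augS Q m)).
  by move=> c; rewrite /= piSC !mcoeffC !eqxx !mulr1.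
by move=> i; rewrite /= piSX aug_linSt mcoeffX mnm1_eq0 rmorph0.
Qed.

(** The difference x - r_{T a} r_a x is a combination of a and T a, and [pi_star] sends T a to
    [tau_star] times the image of a. *)
Lemma folded_refl_diff a x : folded_simple F a ->
  exists t, piU (e x) - piU (folded_refl F a *m e x) = t *: piU (e a).
Proof.
move=> aF; have [aD [ra|[nra _]]] := folded_simpleP aF.
  have rr := simple_root DS aD; have tr := tau_rat_root DS ra.
  rewrite folded_refl_rat // -mulmxA !refl_emb // /root_reflection.
  set k1 := pairing _ x; set k2 := pairing _ (_ - _).
  exists (k1%:~R + k2%:~R * tau_star (qc1 Q) (qc2 Q) (qkind Q)).
  have -> : piU (e (x - k1 *: a - k2 *: tl a)) =
      piU (e x) - k1%:~R *: piU (e a) - k2%:~R *: piU (e (tl a)).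
    by rewrite !raddfB /= !embZ !pi_starE !map_mxB !map_mxZ !mulmxBr -!scalemxAr
      !rmorph_int.
  rewrite emb_tau pi_star_tau; last by move=> /quadratic_datum_split[].
  move: (piU _) (piU _) => v v'.
  by apply/matrixP => i j; rewrite !mxE; ring.
have rr := simple_root DS aD.
rewrite folded_refl_fixed // refl_emb // /root_reflection.
exists (pair a x)%:~R.
rewrite raddfB /= embZ !pi_starE map_mxB map_mxZ mulmxBr -scalemxAr rmorph_int.
by rewrite subKr.
Qed.

(** The difference v - g v is a multiple of b first for v in the image of the lattice, then on its
    l_star-span, in particular for the columns of [bas]; [rmorph_mpoly_dvd] extends this to
    polynomials. *)
Lemma actSt_refl_dvd w a p : W_tau F predT w -> folded_simple F a ->
  exists s, p - actSt bas (w *m folded_refl F a *m invmx w) p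
    = linSt bas (act_star w (piU (e a))) * s.
Proof.
move=> wW aF; set g := _ *m invmx w.
have wV := W_tau_inv DS wW.
have gW : W_tau F predT g.
  by apply: W_tau_mul => //; apply: W_tau_mul => //; exact: W_tau_gen.
set b := act_star w _.
(* With x = w y, the difference x - g x is w applied to y minus its image under the folded
   reflection of a. *)
have gdiff x : exists t, piU (e x) - act_star g (piU (e x)) = t *: b.
  have yE := act_LambdaE x (W_tau_W DS wV).
  set y := act_Lambda F (invmx w) x in yE.
  have wU := W_tau_unit DS wW.
  have xE : e x = w *m e y by rewrite yE mulKVmx.
  have [t ht] := folded_refl_diff y aF.
  exists t; rewrite /b /act_star scalemxAr -ht mulmxBr -!/(act_star _ _).
  rewrite -!pi_star_act ?(W_tau_comm DS wW) ?(W_tau_comm DS gW) // -xE.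
  by rewrite /g -mulmxA -yE mulmxA.
have bL : in_Lambda_tau b by apply: act_in_Lambda_tau => //;
  exact: pi_in_Lambda_tau.
have gdiffL v : in_Lambda_tau v -> exists t, v - act_star g v = t *: b.
  move=> /in_Lambda_tauP [q [c [x ->]]].
  have [t ht] := choice gdiff; exists (\sum_i c i * t (x i)).
  rewrite scaler_suml /act_star mulmx_sumr -sumrB; apply: eq_bigr => i _.
  by rewrite -scalemxAr -scalerBr -/(act_star _ _) ht scalerA.
apply: (rmorph_mpoly_dvd (f := idfun) (g := actSt bas g)) => [c|i] /=.
  by rewrite actStC.
have cL := col_in_Lambda_tau i.
have [t ht] := gdiffL _ cL.
exists t%:MP; rewrite actStX -linSt_col -linStB //;
  last exact: act_in_Lambda_tau.
by rewrite ht linStZ.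
Qed.

End Algebras.

(** * Structure algebras *)

Section StructureAlgebraLemmas.
Variables (V : pointedType) (S K : comNzRingType).
Variables (E : V -> V -> S -> Prop) (eps : {rmorphism S -> K}).
Implicit Types z : structure_algebra E.

Lemma sa_ext z z' : (forall x, sa_val z x = sa_val z' x) -> z = z'.
Proof. by move=> zz'; apply: val_inj; apply: boolp.funext => x; exact: zz'. Qed.

Lemma sa_valD z z' x : sa_val (z + z') x = sa_val z x + sa_val z' x.
Proof. by []. Qed.

Lemma sa_valB z z' x : sa_val (z - z') x = sa_val z x - sa_val z' x.
Proof. by []. Qed.

Lemma sa_valM z z' x : sa_val (z * z') x = sa_val z x * sa_val z' x.
Proof. by []. Qed.

Lemma sa_exists (f : V -> S) :
  (forall x y a, E x y a -> exists s, f x - f y = a * s) ->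
  exists z : structure_algebra E, forall x, sa_val z x = f x.
Proof.
move=> fE; have fP : f \in sa_pred E by rewrite inE.
by exists (StructureAlgebra fP).
Qed.

Lemma sa_edge z x y a : E x y a -> exists s, sa_val z x - sa_val z y = a * s.
Proof. by have := sa_valP z; rewrite inE; apply. Qed.

Lemma sa_reduceB z z' : sa_reduce eps (z - z') =
  sa_reduce eps z - sa_reduce eps z'.
Proof. exact: (rmorphB (\pi_{ideal_quot aug_pred (E := E) eps}%qT)). Qed.

Lemma sa_reduceD z z' : sa_reduce eps (z + z') = sa_reduce eps z +
  sa_reduce eps z'.
Proof. exact: (rmorphD (\pi_{ideal_quot aug_pred (E := E) eps}%qT)). Qed.

Lemma sa_reduceM z z' : sa_reduce eps (z * z') =
  sa_reduce eps z * sa_reduce eps z'.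
Proof. exact: (rmorphM (\pi_{ideal_quot aug_pred (E := E) eps}%qT)). Qed.

Lemma sa_reduce_eq z z' : z - z' \in aug_pred (E := E) eps ->
  sa_reduce eps z = sa_reduce eps z'.
Proof. by rewrite Quotient.idealrBE => /eqP. Qed.

Lemma sa_reduce_repr z :
  repr (sa_reduce eps z : {ideal_quot aug_pred (E := E) eps}) - z \in aug_pred
    (E := E) eps.
Proof. by rewrite Quotient.idealrBE; apply/eqP; rewrite reprK. Qed.

Lemma sa_reduce_surj (u : reduced_sa E eps) : exists z, u = sa_reduce eps z.
Proof. by elim/quotW: u => z; exists z. Qed.

Lemma sa_constB s s' : sa_const E (s - s') = sa_const E s - sa_const E s'.
Proof. exact: sa_ext. Qed.

Lemma sa_constD s s' : sa_const E (s + s') = sa_const E s + sa_const E s'.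
Proof. exact: sa_ext. Qed.

Lemma sa_constM s s' : sa_const E (s * s') = sa_const E s * sa_const E s'.
Proof. exact: sa_ext. Qed.

Lemma sa_reduce_const s s' : eps s = eps s' ->
  sa_reduce eps (sa_const E s) = sa_reduce eps (sa_const E s').
Proof.
move=> ss'; apply: sa_reduce_eq; rewrite -sa_constB inE.
exists 1%N, (fun _ => s - s'), (fun _ => 1); split.
  by move=> _; rewrite rmorphB ss' subrr.
by rewrite big_ord1 mulr1.
Qed.

End StructureAlgebraLemmas.

Section TensorLiftLemmas.
Variables (A M N : comNzRingType) (f : A -> M) (g : A -> N) (G : zmodType).

(** Collects the three hypotheses under which [tensor_lift] computes as expected. *)
Definition balanced (phi : M -> N -> G) :=
  [/\ forall m m' n, phi (m + m') n = phi m n + phi m' n,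
      forall m n n', phi m (n + n') = phi m n + phi m n'
    & forall a m n, phi (f a * m) n = phi m (g a * n)].

Lemma balanced_tens phi : balanced phi ->
  forall m n, tensor_lift phi (tens f g m n) = phi m n.
Proof. by case=> *; apply: tensor_lift_tens. Qed.

Lemma balanced_sub phi : balanced phi -> forall t u : tensor f g,
  tensor_lift phi (t - u) = tensor_lift phi t - tensor_lift phi u.
Proof. by case=> *; apply: tensor_liftB. Qed.

End TensorLiftLemmas.

(** * Existence of the characteristic maps and of [iota_star] *)

Section Maps.
Variables (R : realType) (Q : quadratic_datum R) (n m : nat).
Variables (X : root_datum m) (Delta : seq 'cV[int]_m).
Hypothesis DS : simple_roots X Delta.
Variable F : folded_representation Q n X Delta.

Local Notation N := (n + n)%N.
Local Notation V := 'cV[int]_m.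
Local Notation U := 'cV[Q]_N.
Local Notation e := (emb F).
Local Notation roots := (Defs.roots X).
Local Notation pos := (nonneg_comb Delta).
Local Notation act := (word_act X).
Local Notation L := (lstar (qc1 Q) (qc2 Q) (qkind Q)).
Local Notation piU := (@pi_star Q (qc1 Q) (qc2 Q) n (qkind Q)).
Implicit Types (a : V) (u : U) (P : pred V).
Local Notation tl := (tau_lattice F).
Variables (r : nat) (bas : 'M[L]_(N, r)).
Hypothesis bas_basis : Lambda_tau_basis F bas.
Variables (Theta : seq V) (theta : U).
Hypothesis Theta_simple : {subset Theta <= Delta}.
Hypothesis F_preserves : preserves F Theta.
Hypothesis theta_dominant : dominant F theta.
Hypothesis theta_stabilizer : forall w, W F predT w ->
  (w *m theta = theta <-> W F (mem Theta) w).

Local Notation mu := (piU theta).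
Local Notation orb := (Defs.orbit F theta).
Local Notation orbt := (Defs.orbit_tau F theta).
Local Notation ZG := (ZG F theta).
Local Notation ZGt := (ZGt F bas theta).

Lemma orbit_exists w : W F predT w -> exists x : orb, vertex_val x = w *m theta.
Proof.
move=> wW; have xO : `[< W_orbit F theta (w *m theta) >] by apply/asboolP;
  exists w.
by exists (Vertex xO).
Qed.

Lemma orbit_word (x : orb) : exists2 w, W F predT w & vertex_val x = w *m theta.
Proof. by have /asboolP := vertexP x. Qed.

Lemma orbit_ext (x y : orb) : vertex_val x = vertex_val y -> x = y.
Proof. exact: val_inj. Qed.

Lemma orbit_tau_word (y : orbt) :
  exists2 w, W_tau F predT w & vertex_val y = act_star w mu.
Proof. by have /asboolP := vertexP y. Qed.

(** The first conclusion makes iota independent of the representative, the second makes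
    [char_map_tau] so. *)
Lemma W_tau_mu v w : W_tau F predT v -> W_tau F predT w ->
  act_star v mu = act_star w mu ->
  v *m theta = w *m theta /\ W_tau F (mem Theta) (invmx v *m w).
Proof.
move=> vW wW vw; have vU := W_tau_unit DS vW.
have uW : W_tau F predT (invmx v *m w) by apply: W_tau_mul => //;
  exact: W_tau_inv.
have uth : (invmx v *m w) *m theta = theta.
  apply: (mu_stabilizer DS theta_dominant uW).
  by rewrite act_starM -vw -act_starM mulVmx // /act_star map_mx1 mul1mx.
split; last exact: (W_tau_stabilizer DS Theta_simple theta_dominant
  theta_stabilizer).
by rewrite -{1}uth !mulmxA mulmxV // mul1mx.
Qed.

Lemma W_act_root w a : W F predT w -> a \in roots -> act_Lambda F w a \in roots.
Proof.
move=> wW ra; have /(W_predTP DS) [s sD wE] := wW.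
suff -> : act_Lambda F w a = act s a by exact: (word_act_root DS).
apply: (@emb_inj _ _ _ _ _ _ F); rewrite act_LambdaE // wE word_mx_act //.
exact: (sub_roots DS).
Qed.

(** Edges carry positive roots only, but the roots w a and w (T a) needed for [iota_star] may be
    negative. *)
Lemma ZG_refl (z : ZG) a (x y : orb) : a \in roots ->
  vertex_val y = refl (e a) *m vertex_val x ->
  exists s, sa_val z x - sa_val z y = linS Q a * s.
Proof.
have zpos b : b \in roots -> pos b ->
  vertex_val y = refl (e b) *m vertex_val x ->
    exists s, sa_val z x - sa_val z y = linS Q b * s.
  by move=> rb pb yE; apply: sa_edge; exists b; split.
move=> ra yE; have [pa|na] := simple_span DS ra; first exact: zpos.
have [|s ->] := zpos _ (rootN ra) na; first by rewrite refl_opp.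
exists (- s); rewrite -scaleN1r linSZ.
by rewrite -mulrA; congr (_ * _); rewrite rmorphN rmorph1 mulN1r.
Qed.

(** As [char_map] is picked by [xget] with default 0, its values are known only once some family
    with these values is shown to satisfy the edge conditions. *)
Lemma char_mapP (s : invS F (mem Theta)) w (x : orb) : W F predT w ->
  vertex_val x = w *m theta -> sa_val (char_map theta s) x =
    actS F w (inv_val s).
Proof.
move: w x.
have wd v w : W F predT v -> W F predT w -> v *m theta = w *m theta ->
    actS F w (inv_val s) = actS F v (inv_val s).
  move=> vW wW vw; have vU := W_unit DS vW.
  have uW : W F predT (invmx v *m w) by apply: W_mul => //; exact: (W_inv DS).
  have uT : W F (mem Theta) (invmx v *m w).
    by apply/(theta_stabilizer uW); rewrite -mulmxA -vw mulmxA mulVmx // mul1mx.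
  have sE : actS F (invmx v *m w) (inv_val s) = inv_val s.
    by have := inv_valP s; rewrite inE; apply.
  by rewrite -[in RHS]sE -[RHS](actSM _ vW uW) mulmxA (mulmxV vU) mul1mx.
have /choice [f fP] (x : orb) : exists p, forall w, W F predT w ->
    vertex_val x = w *m theta -> p = actS F w (inv_val s).
  have [w wW xE] := orbit_word x; exists (actS F w (inv_val s)) => v vW xE'.
  by apply: wd => //; rewrite -xE -xE'.
have [z zP] : exists z : ZG, forall x, sa_val z x = f x.
  apply: sa_exists => x y _ [a [[ra _] yE ->]].
  have [w wW xE] := orbit_word x; have rW := refl_root_W DS F ra.
  have yE' : vertex_val y = refl (e a) *m w *m theta by rewrite -mulmxA -xE.
  rewrite (fP x w wW xE) (fP y _ (W_mul rW wW) yE') [X in _ - X](actSM _ rW wW).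
  exact: (actS_refl_dvd DS).
apply: (xgetI 0 (P := [set z : ZG | forall w (x : orb), W F predT w ->
    vertex_val x = w *m theta -> sa_val z x = actS F w (inv_val s)]%classic)
      (x := z)).
by move=> w x wW xE; rewrite zP; exact: fP.
Qed.

Lemma char_map_tauP (s : invSt F bas (mem Theta)) w (y : orbt) :
  W_tau F predT w ->
  vertex_val y = act_star w mu ->
  sa_val (char_map_tau theta s) y = actSt bas w (inv_val s).
Proof.
move: w y.
have wd v w : W_tau F predT v -> W_tau F predT w ->
  act_star v mu = act_star w mu ->
    actSt bas w (inv_val s) = actSt bas v (inv_val s).
  move=> vW wW vw; have vU := W_tau_unit DS vW.
  have [_ uT] := W_tau_mu vW wW vw.
  have uW := W_tau_sub uT.
  have sE : actSt bas (invmx v *m w) (inv_val s) = inv_val s.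
    by have := inv_valP s; rewrite inE; apply.
  by rewrite -[in RHS]sE -[RHS](actStM DS bas_basis _ vW uW) mulmxA (mulmxV vU)
    mul1mx.
have /choice [f fP] (y : orbt) : exists p, forall w, W_tau F predT w ->
    vertex_val y = act_star w mu -> p = actSt bas w (inv_val s).
  have [w wW yE] := orbit_tau_word y.
  exists (actSt bas w (inv_val s)) => v vW yE'.
  by apply: wd => //; rewrite -yE -yE'.
have [z zP] : exists z : ZGt, forall y, sa_val z y = f y.
  apply: sa_exists => y y' _ [w [a [wW aF _ yE' ->]]].
  have [v vW yE] := orbit_tau_word y.
  have gW : W_tau F predT (w *m folded_refl F a *m invmx w).
    apply: W_tau_mul; last exact: W_tau_inv.
    by apply: W_tau_mul => //; exact: W_tau_gen.
  have yE2 : vertex_val y' = act_star (w *m folded_refl F a *m invmx w *m v) mu.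
    by rewrite yE' yE [RHS]act_starM.
  rewrite (fP y v vW yE) (fP y' _ (W_tau_mul gW vW) yE2).
  rewrite [X in _ - X](actStM DS bas_basis _ gW vW).
  exact: (actSt_refl_dvd DS bas_basis).
apply: (xgetI 0 (P := [set z : ZGt | forall w (y : orbt), W_tau F predT w ->
  vertex_val y = act_star w mu -> sa_val z y = actSt bas w (inv_val s)]%classic)
    (x := z)).
by move=> w y wW yE; rewrite zP; exact: fP.
Qed.

Lemma iota_starP (z : ZG) w (y : orbt) (x : orb) : W_tau F predT w ->
  vertex_val y = act_star w mu -> vertex_val x = w *m theta ->
  sa_val (iota_star bas z) y = piS F bas (sa_val z x).
Proof.
move: w y x.
have /choice [f fP] (y : orbt) : exists p, forall w (x : orb),
  W_tau F predT w ->
    vertex_val y = act_star w mu -> vertex_val x = w *m theta ->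
    p = piS F bas (sa_val z x).
  have [w wW yE] := orbit_tau_word y;
    have [x xE] := orbit_exists (W_tau_W DS wW).
  exists (piS F bas (sa_val z x)) => v x' vW yE' xE';
    congr (piS F bas (sa_val z _)).
  apply: orbit_ext; rewrite xE xE'.
  by have [] := W_tau_mu wW vW; rewrite -?yE -?yE'.
have [b bP] : exists b : ZGt, forall y, sa_val b y = f y.
  apply: sa_exists => y y' _ [w [a [wW aF _ yE' ->]]].
  have [v vW yE] := orbit_tau_word y.
  have wWW := W_tau_W DS wW; have wU := W_unit DS wWW.
  have gW : W_tau F predT (w *m folded_refl F a *m invmx w).
    apply: W_tau_mul; last exact: W_tau_inv.
    by apply: W_tau_mul => //; exact: W_tau_gen.
  have gvW : W_tau F predT (w *m folded_refl F a *m invmx w *m v) by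
    exact: W_tau_mul.
  have [x xE] := orbit_exists (W_tau_W DS vW).
  have [x' xE'] := orbit_exists (W_tau_W DS gvW).
  have yE2 : vertex_val y' = act_star (w *m folded_refl F a *m invmx w *m v) mu.
    by rewrite yE' yE [RHS]act_starM.
  rewrite (fP y v x vW yE xE) (fP y' _ x' gvW yE2 xE').
  have wrefl c : c \in roots ->
      w *m refl (e c) = refl (e (act_Lambda F w c)) *m w.
    move=> rc; apply: (refl_conj (F := F)) => //.
    - exact: (W_isometry DS wWW).
    - exact: W_act_root.
    - by rewrite act_LambdaE.
  have linE c : linSt bas (piU (e (act_Lambda F w c))) =
    linSt bas (act_star w (piU (e c))).
    by rewrite act_LambdaE // pi_star_act // (W_tau_comm DS wW).
  have [aD [ra|[nra _]]] := folded_simpleP aF; have rr := simple_root DS aD.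
    have tr := tau_rat_root DS ra.
    have wr1 := W_act_root wWW rr; have wr2 := W_act_root wWW tr.
    (* The intermediate vertex x1 = r_{w a} x splits the step from x to x' = r_{w T a} r_{w a} x
       into two edges of the big graph, although x1 need not come from the small orbit. *)
    have [x1 x1E] := orbit_exists (W_mul (refl_root_W DS F wr1)
      (W_tau_W DS vW)).
    have [s1 h1] : exists s, sa_val z x - sa_val z x1 =
      linS Q (act_Lambda F w a) * s.
      by apply: ZG_refl => //; rewrite x1E xE mulmxA.
    have [s2 h2] : exists s,
        sa_val z x1 - sa_val z x' = linS Q (act_Lambda F w (tl a)) * s.
      apply: ZG_refl => //; rewrite x1E xE' folded_refl_rat //.
      rewrite !mulmxA wrefl // -[_ *m w *m refl (e a)]mulmxA wrefl // mulmxA.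
      by rewrite mulmxK.
    have := congr1 (piS F bas) h1; have := congr1 (piS F bas) h2.
    rewrite !(rmorphM, rmorphB) /= !(piS_lin bas_basis) !linE => h2' h1'.
    have tE : linSt bas (act_star w (piU (e (tl a))))
        = linSt bas (act_star w (piU (e a))) *
          (tau_star (qc1 Q) (qc2 Q) (qkind Q))%:MP.
      rewrite emb_tau pi_star_tau; last by move=> /quadratic_datum_split[].
      rewrite /act_star -scalemxAr (linStZ bas_basis) //.
      apply: (act_in_Lambda_tau DS bas_basis wW).
      exact: (pi_in_Lambda_tau bas_basis).
    rewrite tE in h2'.
    exists (piS F bas s1 + (tau_star (qc1 Q) (qc2 Q) (qkind Q))%:MP * piS F bas
      s2).
    by rewrite mulrDr mulrA -h1' -h2' addrA subrK.
  have wr1 := W_act_root wWW rr.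
  have [s h] : exists s, sa_val z x - sa_val z x' =
    linS Q (act_Lambda F w a) * s.
    apply: ZG_refl => //; rewrite xE' folded_refl_fixed // wrefl // mulmxK //
      xE.
    by rewrite mulmxA.
  exists (piS F bas s).
  have := congr1 (piS F bas) h.
  by rewrite !(rmorphM, rmorphB) /= (piS_lin bas_basis) linE.
apply: (xgetI 0 (P := [set b : ZGt | forall w (y : orbt) (x : orb),
  W_tau F predT w -> vertex_val y = act_star w mu ->
  vertex_val x = w *m theta -> sa_val b y = piS F bas (sa_val z x)]%classic)
    (x := b)).
by move=> w y x wW yE xE; rewrite bP; exact: (fP y w x).
Qed.

End Maps.

(** * The cube *)

Section Diagram.
Variables (R : realType) (Q : quadratic_datum R) (n m : nat).
Variables (X : root_datum m) (Delta : seq 'cV[int]_m).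
Hypothesis DS : simple_roots X Delta.
Variable F : folded_representation Q n X Delta.

Local Notation N := (n + n)%N.
Local Notation V := 'cV[int]_m.
Local Notation U := 'cV[Q]_N.
Local Notation L := (lstar (qc1 Q) (qc2 Q) (qkind Q)).
Local Notation toL := (to_lstar (qc1 Q) (qc2 Q) (qkind Q)).
Implicit Types (a : V) (u : U) (P : pred V).
Variables (r : nat) (bas : 'M[L]_(N, r)).
Hypothesis bas_basis : Lambda_tau_basis F bas.
Variables (Theta : seq V) (theta : U).
Hypothesis Theta_simple : {subset Theta <= Delta}.
Hypothesis F_preserves : preserves F Theta.
Hypothesis theta_dominant : dominant F theta.
Hypothesis theta_stabilizer : forall w, W F predT w ->
  (w *m theta = theta <-> W F (mem Theta) w).

Local Notation orb := (Defs.orbit F theta).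
Local Notation orbt := (Defs.orbit_tau F theta).
Local Notation ZG := (ZG F theta).
Local Notation ZGt := (ZGt F bas theta).

Lemma piS_invariant P P' p : (forall w, W_tau F P' w -> W F P w) ->
  p \in inv_pred (actS F) (W F P) ->
  piS F bas p \in inv_pred (actSt bas) (W_tau F P').
Proof.
move=> sP; rewrite !inE => pW w wW.
by rewrite -(piS_act DS bas_basis) ?pW //; [exact: sP | exact: W_tau_sub wW].
Qed.

(** The default 0 in [pi_inv] is never reached, because W_{Theta_tau} lies in W_Theta. *)
Lemma pi_invE (s : invS F (mem Theta)) :
  inv_val (pi_inv bas s) = piS F bas (inv_val s).
Proof.
rewrite /pi_inv val_insubd (piS_invariant _ (inv_valP s)) // => w.
exact: (W_tau_Theta_W DS Theta_simple F_preserves theta_stabilizer).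
Qed.

(** The map on base rings, along which the tensor products over S^W are compared with those over the
    W_tau-invariants. *)
Definition pi_inv_full (s : invS F predT) : invSt F bas predT :=
  Invariant (piS_invariant (@W_tau_W _ _ _ _ _ _ DS F predT) (inv_valP s)).

Lemma inv_valD (A : comNzRingType) (I : Type) (f : I -> {rmorphism A -> A})
  (G : I -> Prop)
  (s s' : invariants f G) : inv_val (s + s') = inv_val s + inv_val s'.
Proof. by []. Qed.

Lemma inv_valM (A : comNzRingType) (I : Type) (f : I -> {rmorphism A -> A})
  (G : I -> Prop)
  (s s' : invariants f G) : inv_val (s * s') = inv_val s * inv_val s'.
Proof. by []. Qed.

Lemma inv_ext (A : comNzRingType) (I : Type) (f : I -> {rmorphism A -> A})
  (G : I -> Prop)
  (s s' : invariants f G) : inv_val s = inv_val s' -> s = s'.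
Proof. exact: val_inj. Qed.

Lemma inv_fixed (A : comNzRingType) (I : Type) (f : I -> {rmorphism A -> A})
  (G : I -> Prop)
  (s : invariants f G) w : G w -> f w (inv_val s) = inv_val s.
Proof. by have := inv_valP s; rewrite inE; apply. Qed.

Lemma char_mapD (s s' : invS F (mem Theta)) :
  char_map theta (s + s') = char_map theta s + char_map theta s'.
Proof.
apply: sa_ext => x; have [w wW xE] := orbit_word x.
have cP s0 := char_mapP DS theta_stabilizer s0 wW xE.
by rewrite [LHS]cP [RHS]sa_valD [X in _ = X + _]cP [X in _ = _ + X]cP
  (inv_valD s s') [LHS]rmorphD.
Qed.

(** A W-invariant a is fixed by every w, so its image in Z(G) is the constant family. *)
Lemma char_map_bal (a : invS F predT) (s : invS F (mem Theta)) :
  char_map theta (inv_incl (@W_sub _ _ _ _ _ _ F (mem Theta)) a * s)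
    = sa_const _ (inv_val a) * char_map theta s.
Proof.
apply: sa_ext => x; have [w wW xE] := orbit_word x.
have cP s0 := char_mapP DS theta_stabilizer s0 wW xE.
by rewrite [LHS]cP [RHS]sa_valM (cP s) (inv_valM _ s) [LHS]rmorphM /=
  (inv_fixed a wW).
Qed.

Lemma char_map_tauD (s s' : invSt F bas (mem Theta)) :
  char_map_tau theta (s + s') = char_map_tau theta s + char_map_tau theta s'.
Proof.
apply: sa_ext => y; have [w wW yE] := orbit_tau_word y.
have cP s0 :=
  char_map_tauP DS bas_basis Theta_simple theta_dominant theta_stabilizer s0 wW
    yE.
by rewrite [LHS]cP [RHS]sa_valD [X in _ = X + _]cP [X in _ = _ + X]cP
  (inv_valD s s') [LHS]rmorphD.
Qed.

Lemma char_map_tau_bal (a : invSt F bas predT) (s : invSt F bas (mem Theta)) :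
  char_map_tau theta (inv_incl (@W_tau_sub _ _ _ _ _ _ F (mem Theta)) a * s)
    = sa_const _ (inv_val a) * char_map_tau theta s.
Proof.
apply: sa_ext => y; have [w wW yE] := orbit_tau_word y.
have cP s0 :=
  char_map_tauP DS bas_basis Theta_simple theta_dominant theta_stabilizer s0 wW
    yE.
by rewrite [LHS]cP [RHS]sa_valM (cP s) (inv_valM _ s) [LHS]rmorphM /=
  (inv_fixed a wW).
Qed.

Lemma iota_star_val (y : orbt) :
  exists x : orb, forall z : ZG, sa_val (iota_star bas z) y =
    piS F bas (sa_val z x).
Proof.
have [w wW yE] := orbit_tau_word y;
  have [x xE] := orbit_exists theta (W_tau_W DS wW).
exists x => z'.
exact: (iota_starP DS bas_basis Theta_simple theta_dominant theta_stabilizer z'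
  wW yE xE).
Qed.

Lemma iota_starB z z' :
  iota_star bas (z - z') = iota_star bas z - iota_star bas z' :> ZGt.
Proof.
apply: sa_ext => y; have [x xP] := iota_star_val y.
by rewrite [LHS]xP [RHS]sa_valB [X in _ = X - _]xP [X in _ = _ - X]xP
  (sa_valB z z') [LHS]rmorphB.
Qed.

Lemma iota_starM z z' :
  iota_star bas (z * z') = iota_star bas z * iota_star bas z' :> ZGt.
Proof.
apply: sa_ext => y; have [x xP] := iota_star_val y.
by rewrite [LHS]xP [RHS]sa_valM [X in _ = X * _]xP [X in _ = _ * X]xP
  (sa_valM z z') [LHS]rmorphM.
Qed.

Lemma iota_star_const (s : symS Q m) :
  iota_star bas (sa_const _ s : ZG) = sa_const _ (piS F bas s) :> ZGt.
Proof. by apply: sa_ext => y; have [x xP] := iota_star_val y; rewrite xP. Qed.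

Lemma iota_star_char (s : invS F (mem Theta)) :
  iota_star bas (char_map theta s) = char_map_tau theta (pi_inv bas s).
Proof.
apply: sa_ext => y; have [w wW yE] := orbit_tau_word y.
have wWW := W_tau_W DS wW; have [x xE] := orbit_exists theta wWW.
rewrite (iota_starP DS bas_basis Theta_simple theta_dominant theta_stabilizer _
  wW yE xE).
rewrite (char_mapP DS theta_stabilizer _ wWW xE).
rewrite (char_map_tauP DS bas_basis Theta_simple theta_dominant theta_stabilizer
  _ wW yE).
by rewrite pi_invE (piS_act DS bas_basis).
Qed.

(** The map [piS] commutes with the augmentations, so [iota_star] sends I Z(G) into I_tau Z(G_tau).
    This frees [iota_bar] from the choice of representative made by [repr]. *)
Lemma iota_star_aug (z z' : ZG) : fG z = fG z' ->
  fGt (iota_star bas z) = fGt (iota_star bas z').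
Proof.
move=> zz'; apply: sa_reduce_eq; rewrite -iota_starB.
have : z - z' \in aug_pred (augS Q m) by rewrite Quotient.idealrBE; apply/eqP.
rewrite !inE => -[q [s [b [s0 ->]]]].
exists q, (fun i => piS F bas (s i)), (fun i => iota_star bas (b i));
  split=> [i|].
  by rewrite (aug_piS F bas) s0 rmorph0.
have i0 : iota_star bas (0 : ZG) = 0 :> ZGt.
  by rewrite -[X in iota_star _ X](subrr 0) iota_starB subrr.
have iN (b1 : ZG) : iota_star bas (- b1) = - iota_star bas b1.
  by rewrite -[- b1]sub0r iota_starB i0 sub0r.
have iD (b1 b2 : ZG) : iota_star bas (b1 + b2) = iota_star bas b1 +
  iota_star bas b2.
  by rewrite -[b2 in LHS]opprK iota_starB iN opprK.
rewrite (big_morph (fun b0 : ZG => iota_star bas b0 : ZGt) iD i0);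
  apply: eq_bigr => i _.
by rewrite iota_starM iota_star_const.
Qed.

Lemma iota_bar_fG (z : ZG) : iota_bar bas (fG z) = fGt (iota_star bas z).
Proof.
apply: iota_star_aug; apply: sa_reduce_eq; exact: sa_reduce_repr.
Qed.

Lemma iota_barB (u v : ZGbar F theta) :
  iota_bar bas (u - v) = iota_bar bas u - iota_bar bas v.
Proof.
have [[z ->] [z' ->]] := (sa_reduce_surj u, sa_reduce_surj v).
rewrite -sa_reduceB -!/(fG _) !iota_bar_fG iota_starB; exact: sa_reduceB.
Qed.

Lemma rho_balanced : balanced (A := invS F predT) inv_val
  (inv_incl (@W_sub _ _ _ _ _ _ F (mem Theta)))
  (fun s1 s2 => sa_const _ s1 * char_map theta s2 : ZG).
Proof.
split=> [s s' t|s t t'|a s t].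
- by rewrite sa_constD mulrDl.
- by rewrite char_mapD mulrDr.
- by rewrite char_map_bal sa_constM mulrCA mulrA.
Qed.

Lemma rho_tau_balanced : balanced (A := invSt F bas predT) inv_val
  (inv_incl (@W_tau_sub _ _ _ _ _ _ F (mem Theta)))
  (fun s1 s2 => sa_const _ s1 * char_map_tau theta s2 : ZGt).
Proof.
split=> [s s' t|s t t'|a s t].
- by rewrite sa_constD mulrDl.
- by rewrite char_map_tauD mulrDr.
- by rewrite char_map_tau_bal sa_constM mulrCA mulrA.
Qed.

(** Balancing holds only after reduction: an invariant and its constant term differ by an element of
    I, so they act alike on the quotient. *)
Lemma rho_bar_balanced : balanced
  (augS Q m \o (inv_val : invS F predT -> symS Q m))
  (inv_incl (@W_sub _ _ _ _ _ _ F (mem Theta)))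
  (fun c s => fG (sa_const _ (constS Q m c)) * fG (char_map theta s) :
    ZGbar F theta).
Proof.
split=> [c c' s|c s s'|b c s].
- by rewrite rmorphD sa_constD /fG sa_reduceD mulrDl.
- by rewrite char_mapD /fG sa_reduceD mulrDr.
rewrite char_map_bal rmorphM sa_constM /fG !sa_reduceM mulrCA -mulrA;
  congr (_ * _).
by apply: sa_reduce_const; rewrite /= mcoeffC eqxx mulr1.
Qed.

Lemma rho_tau_bar_balanced : balanced
  (augSt Q r \o (inv_val : invSt F bas predT -> symSt Q r))
  (inv_incl (@W_tau_sub _ _ _ _ _ _ F (mem Theta)))
  (fun c s => fGt (sa_const _ (constSt Q r c)) * fGt (char_map_tau theta s)
     : ZGtbar F bas theta).
Proof.
split=> [c c' s|c s s'|b c s].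
- by rewrite rmorphD sa_constD /fGt sa_reduceD mulrDl.
- by rewrite char_map_tauD /fGt sa_reduceD mulrDr.
rewrite char_map_tau_bal rmorphM sa_constM /fGt !sa_reduceM mulrCA -mulrA;
  congr (_ * _).
by apply: sa_reduce_const; rewrite /= mcoeffC eqxx mulr1.
Qed.

Lemma aug_id_balanced : balanced (A := invS F predT) inv_val
  (inv_incl (@W_sub _ _ _ _ _ _ F (mem Theta)))
  (fun s1 s2 => tens _ _ (augS Q m s1) s2 : kxS F Theta).
Proof.
split=> [s s' t|s t t'|a s t].
- by rewrite rmorphD tensDl.
- exact: tensDr.
- by rewrite rmorphM -tens_bal.
Qed.

Lemma aug_tau_id_balanced : balanced (A := invSt F bas predT) inv_val
  (inv_incl (@W_tau_sub _ _ _ _ _ _ F (mem Theta)))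
  (fun s1 s2 => tens _ _ (augSt Q r s1) s2 : lxSt F bas Theta).
Proof.
split=> [s s' t|s t t'|a s t].
- by rewrite rmorphD tensDl.
- exact: tensDr.
- by rewrite rmorphM -tens_bal.
Qed.

Lemma pi_invD (s s' : invS F (mem Theta)) :
  pi_inv bas (s + s') = pi_inv bas s + pi_inv bas s'.
Proof.
apply: inv_ext.
rewrite [LHS]pi_invE [RHS]inv_valD [X in _ = X + _]pi_invE
  [X in _ = _ + X]pi_invE.
by rewrite (inv_valD s s') [LHS]rmorphD.
Qed.

Lemma pi_inv_bal (a : invS F predT) (s : invS F (mem Theta)) :
  pi_inv bas (inv_incl (@W_sub _ _ _ _ _ _ F (mem Theta)) a * s)
    = inv_incl (@W_tau_sub _ _ _ _ _ _ F (mem Theta)) (pi_inv_full a) * pi_inv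
      bas s.
Proof.
apply: inv_ext; rewrite [LHS]pi_invE [RHS]inv_valM [X in _ = _ * X]pi_invE.
by rewrite (inv_valM _ s) [LHS]rmorphM.
Qed.

Lemma pi_pi_balanced : balanced (A := invS F predT) inv_val
  (inv_incl (@W_sub _ _ _ _ _ _ F (mem Theta)))
  (fun s1 s2 => tens _ _ (piS F bas s1) (pi_inv bas s2) : StxSt F bas Theta).
Proof.
split=> [s s' t|s t t'|a s t].
- by rewrite rmorphD tensDl.
- by rewrite pi_invD tensDr.
- by rewrite pi_inv_bal rmorphM -tens_bal.
Qed.

Lemma pi_bar_balanced : balanced
  (augS Q m \o (inv_val : invS F predT -> symS Q m))
  (inv_incl (@W_sub _ _ _ _ _ _ F (mem Theta)))
  (fun c s => tens _ _ (toL c) (pi_inv bas s) : lxSt F bas Theta).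
Proof.
split=> [c c' s|c s s'|b c s].
- by rewrite rmorphD tensDl.
- by rewrite pi_invD tensDr.
- by rewrite pi_inv_bal rmorphM -tens_bal /= aug_piS.
Qed.

Lemma fG_rho (t : SxS F Theta) : fG (rho theta t) = rho_bar theta (aug_id t).
Proof.
elim/tensor_ind: t => [s1 s2|t t' ht ht'].
  rewrite /rho /aug_id /rho_bar (balanced_tens rho_balanced).
  rewrite (balanced_tens aug_id_balanced) (balanced_tens rho_bar_balanced).
  rewrite /fG sa_reduceM; congr (_ * _).
  by apply: sa_reduce_const; rewrite /= mcoeffC eqxx mulr1.
rewrite /rho /aug_id /rho_bar (balanced_sub rho_balanced)
  (balanced_sub aug_id_balanced).
rewrite (balanced_sub rho_bar_balanced) /fG sa_reduceB.
by congr (_ - _).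
Qed.

Lemma fGt_rho_tau (t : StxSt F bas Theta) :
  fGt (rho_tau theta t) = rho_tau_bar theta (aug_tau_id t).
Proof.
elim/tensor_ind: t => [s1 s2|t t' ht ht'].
  rewrite /rho_tau /aug_tau_id /rho_tau_bar (balanced_tens rho_tau_balanced).
  rewrite (balanced_tens aug_tau_id_balanced)
    (balanced_tens rho_tau_bar_balanced).
  rewrite /fGt sa_reduceM; congr (_ * _).
  by apply: sa_reduce_const; rewrite /= mcoeffC eqxx mulr1.
rewrite /rho_tau /aug_tau_id /rho_tau_bar (balanced_sub rho_tau_balanced).
rewrite (balanced_sub aug_tau_id_balanced).
rewrite (balanced_sub rho_tau_bar_balanced) /fGt sa_reduceB.
by congr (_ - _).
Qed.

Lemma iota_star_rho (t : SxS F Theta) :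
  iota_star bas (rho theta t) = rho_tau theta (pi_pi bas t).
Proof.
elim/tensor_ind: t => [s1 s2|t t' ht ht'].
  rewrite /rho /pi_pi /rho_tau (balanced_tens rho_balanced).
  rewrite (balanced_tens pi_pi_balanced) (balanced_tens rho_tau_balanced).
  by rewrite iota_starM iota_star_const iota_star_char.
rewrite /rho /pi_pi /rho_tau (balanced_sub rho_balanced)
  (balanced_sub pi_pi_balanced).
rewrite (balanced_sub rho_tau_balanced) iota_starB.
by congr (_ - _).
Qed.

Lemma iota_bar_rho_bar (t : kxS F Theta) :
  iota_bar bas (rho_bar theta t) = rho_tau_bar theta (pi_bar bas t).
Proof.
elim/tensor_ind: t => [c s|t t' ht ht'].
  rewrite /rho_bar /pi_bar /rho_tau_bar (balanced_tens rho_bar_balanced).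
  rewrite (balanced_tens pi_bar_balanced) (balanced_tens rho_tau_bar_balanced).
  rewrite /fG -sa_reduceM iota_bar_fG iota_starM iota_star_const iota_star_char.
  by rewrite /fGt sa_reduceM piSC.
rewrite /rho_bar /pi_bar /rho_tau_bar (balanced_sub rho_bar_balanced).
rewrite (balanced_sub pi_bar_balanced) (balanced_sub rho_tau_bar_balanced)
  iota_barB.
by congr (_ - _).
Qed.

Lemma aug_tau_id_pi_pi (t : SxS F Theta) :
  aug_tau_id (pi_pi bas t) = pi_bar bas (aug_id t).
Proof.
elim/tensor_ind: t => [s1 s2|t t' ht ht'].
  rewrite /aug_tau_id /pi_pi /pi_bar /aug_id (balanced_tens pi_pi_balanced).
  rewrite (balanced_tens aug_tau_id_balanced) (balanced_tens aug_id_balanced).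
  by rewrite (balanced_tens pi_bar_balanced) aug_piS.
rewrite /aug_tau_id /pi_pi /pi_bar /aug_id (balanced_sub pi_pi_balanced).
rewrite (balanced_sub aug_tau_id_balanced) (balanced_sub aug_id_balanced).
by rewrite (balanced_sub pi_bar_balanced); congr (_ - _).
Qed.

End Diagram.

Theorem lemma6p4 (R : realType) (Q : quadratic_datum R) (n m : nat)
    (X : root_datum m) (Delta : seq 'cV[int]_m)
    (Delta_simple : simple_roots X Delta)
    (F : folded_representation Q n X Delta)
    (r : nat) (bas : 'M[lstar (qc1 Q) (qc2 Q) (qkind Q)]_(n + n, r))
    (bas_basis : Lambda_tau_basis F bas)
    (Theta : seq 'cV[int]_m) (Theta_simple : {subset Theta <= Delta})
    (F_preserves : preserves F Theta)
    (theta : 'cV[Q]_(n + n)) (theta_dominant : dominant F theta)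
    (theta_stabilizer : forall w, W F predT w ->
       (w *m theta = theta <-> W F (mem Theta) w)) :
  (forall t : SxS F Theta,
     fG (rho theta t) = rho_bar theta (aug_id t)) /\
  (forall t : StxSt F bas Theta,
     fGt (rho_tau theta t) = rho_tau_bar theta (aug_tau_id t)) /\
  (forall t : SxS F Theta,
     iota_star bas (rho theta t) = rho_tau theta (pi_pi bas t)) /\
  (forall t : kxS F Theta,
     iota_bar bas (rho_bar theta t) = rho_tau_bar theta (pi_bar bas t)) /\
  (forall t : SxS F Theta,
     aug_tau_id (pi_pi bas t) = pi_bar bas (aug_id t)) /\
  (forall z : ZG F theta,
     fGt (iota_star bas z) = iota_bar bas (fG z)).
Proof.
split; first exact: (fG_rho Delta_simple theta_stabilizer).
split; first exact: (fGt_rho_tau Delta_simple bas_basis Theta_simple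
  theta_dominant theta_stabilizer).
split; first exact: (iota_star_rho Delta_simple bas_basis Theta_simple
  F_preserves theta_dominant theta_stabilizer).
split; first exact: (iota_bar_rho_bar Delta_simple bas_basis Theta_simple
  F_preserves theta_dominant theta_stabilizer).
split; first exact: (aug_tau_id_pi_pi Delta_simple bas_basis Theta_simple
  F_preserves theta_stabilizer).
move=> z; symmetry.
exact: (iota_bar_fG Delta_simple bas_basis Theta_simple theta_dominant
  theta_stabilizer).
Qed.
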